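(* Let $\mathcal F:\mathcal P_2(\mathbb R^d)\to(-\infty,\infty]$ be proper, lower semicontinuous and geodesically convex, with minimizer $\pi$. Let $(\mu_t)_{t\ge0}$ be the forward Euler iterates with adaptive step sizes $\eta_t=\bar r_t/\sqrt{G_t}$, $t\ge0$, where $\bar r_t=\max\{r_\varepsilon,\max_{0\le s\le t}W_2(\mu_0,\mu_s)\}$, $G_t=\sum_{s=0}^t\int_{\mathbb R^d}\|\xi_s(x)\|^2\,\mathrm d\mu_s(x)$, $\xi_s=\nabla_{W_2}\mathcal F(\mu_s)$, and $r_\varepsilon>0$. Let $d_0=W_2(\mu_0,\pi)$ and let $(\bar\mu_t)_{t\ge1}$ be the uniform averages $\bar\mu_1=\mu_0$, $\bar\mu_{t+1}=\big[(1-\tfrac1{t+1})\,\mathrm{id}+\tfrac1{t+1}\,\boldsymbol t_{\bar\mu_t}^{\mu_t}\big]_\#\bar\mu_t$ for $t\ge1$. Then there is a universal constant $C>0$ such that for all $T\ge1$, $$\mathcal F(\bar\mu_T)-\mathcal F(\pi)\le C\,\frac{\big(d_0\log_+\frac{\bar r_T}{r_\varepsilon}+\bar r_T\big)\sqrt{G_{T-1}}}{T}.$$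
   Context: $\log_+(x):=1+\log x$. $\mathcal P_2(\mathbb R^d)$: Borel probability measures on $\mathbb R^d$ with finite second moment; $W_2$: quadratic Wasserstein distance; $T_\#\mu$: pushforward; $\boldsymbol t_\mu^\nu$: optimal transport map from $\mu$ to $\nu$ (whenever written, it is assumed to exist; the paper restricts the domain $\{\mathcal F<\infty\}$ to absolutely continuous measures for this purpose). Proper: $\mathcal F(\mu)<\infty$ for some $\mu$. Geodesically convex: for all $\mu,\nu$ there is a constant speed $W_2$-geodesic $(\lambda_s)_{s\in[0,1]}$ from $\mu$ to $\nu$ with $\mathcal F(\lambda_s)\le(1-s)\mathcal F(\mu)+s\mathcal F(\nu)$ for all $s\in[0,1]$. Wasserstein gradient: $\xi\in L^2(\mu)$ belongs to the Fréchet subdifferential $\partial\mathcal F(\mu)$ if $\mathcal F(\nu)-\mathcal F(\mu)\ge\int\langle\xi(x),\boldsymbol t_\mu^\nu(x)-x\rangle\,\mathrm d\mu(x)+o(W_2(\mu,\nu))$ for all $\nu$ with $\mathcal F(\nu)<\infty$; for geodesically convex $\mathcal F$ this is equivalent to the same inequality without the $o(\cdot)$ term. $\nabla_{W_2}\mathcal F(\mu)$ is the element of $\partial\mathcal F(\mu)$ of minimal $L^2(\mu)$ norm (assumed to exist along the iterates). In the paper, $\mathcal F(\mu)=\int V\,\mathrm d\mu+\frac12\iint W(x-y)\,\mathrm d\mu(x)\mathrm d\mu(y)+\int H(\mu(x))\,\mathrm dx$ is a sum of potential, interaction and internal energies. Forward Euler iterates: given $\mu_0\in\mathcal P_2(\mathbb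 R^d)$ and step sizes $\eta_t>0$, $\mu_{t+1}=(\mathrm{id}-\eta_t\xi_t)_\#\mu_t$ with $\xi_t=\nabla_{W_2}\mathcal F(\mu_t)$, $t\ge0$. Denominators in the step size formula are understood to be positive. *)

(* Defs.v *)
From HB Require Import structures.
From mathcomp Require Import all_boot all_order all_algebra.
From mathcomp Require Import all_classical all_reals all_analysis.
From mathcomp Require Import measurable_realfun.

Set Implicit Arguments.
Unset Strict Implicit.
Unset Printing Implicit Defensive.
Import Order.TTheory GRing.Theory Num.Theory.
Import numFieldNormedType.Exports.
Local Open Scope classical_set_scope.
Local Open Scope ring_scope.

(* R^d is 'rV[R]_d.  It carries the sigma-algebra generated by the coordinate
   maps, as n.-tuple R does in the library; [measurable_rVE] below shows that
   this is the Borel sigma-algebra. *)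
Definition rV_display : measure_display -> measure_display.
Proof. exact. Qed.

Section measurable_rV.
Context {R : realType} {d : nat}.

Let coord (i : 'I_d) (x : 'rV[R]_d) : R := x ord0 i.

Let rV_set0 : g_sigma_preimage coord set0.
Proof. exact: sigma_algebra0. Qed.

Let rV_setC A : g_sigma_preimage coord A -> g_sigma_preimage coord (~` A).
Proof. exact: sigma_algebraC. Qed.

Let rV_bigcup (A : _^nat) : (forall i, g_sigma_preimage coord (A i)) ->
  g_sigma_preimage coord (\bigcup_i (A i)).
Proof. exact: sigma_algebra_bigcup. Qed.

HB.instance Definition _ :=
  @isMeasurable.Build (rV_display default_measure_display)
    'rV[R]_d (g_sigma_preimage coord) rV_set0 rV_setC rV_bigcup.

Lemma measurable_coord (i : 'I_d) :
  measurable_fun [set: 'rV[R]_d] (fun x => x ord0 i).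
Proof.
move=> _ Y mY; rewrite setTI; apply: sub_sigma_algebra => /=.
rewrite -bigcup_seq/=; exists i => /=; first by rewrite mem_index_enum.
by exists Y => //; rewrite setTI.
Qed.

Lemma measurable_rVE : @measurable _ 'rV[R]_d = <<s @open 'rV[R]_d >>.
Proof.
apply/seteqP; split=> A.
  apply: smallest_sub; first exact: smallest_sigma_algebra.
  rewrite -bigcup_seq => B [i _ [Y mY <-]]; rewrite setTI.
  suff : measurable_fun setT
      (coord i : g_sigma_algebraType (@open 'rV[R]_d) -> R).
    by move=> /(_ measurableT _ mY); rewrite setTI.
  apply: (measurability _ (RGenOpens.measurableE R)).
  move=> _ [_ [a [b ->]] <-]; rewrite setTI; apply: sub_sigma_algebra => /=.
  apply: open_comp; last exact: interval_open.
  by move=> x _; exact: coord_continuous.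
apply: smallest_sub; first exact: sigma_algebra_measurable.
move=> U oU.
pose box (f : {ffun 'I_d -> rat * rat}) : set 'rV[R]_d :=
  \bigcap_i [set x | ratr (f i).1 < x ord0 i < ratr (f i).2].
have -> : U = \bigcup_f [set x | box f x /\ box f `<=` U].
  apply/seteqP; split=> [x Ux|x [f _ [fx]]]; last exact.
  have [P nP PU] : nbhs x U by exact: open_nbhs_nbhs.
  have /choice[f fP] : forall i : 'I_d, exists q : rat * rat,
      ratr q.1 < x ord0 i < ratr q.2 /\
      [set y : R | ratr q.1 < y < ratr q.2] `<=` P ord0 i.
    move=> i; have /nbhs_ballP[e /= e0 eP] := nP ord0 i.
    have xe : x ord0 i - e < x ord0 i by rewrite ltrBlDr ltrDl.
    have ex : x ord0 i < x ord0 i + e by rewrite ltrDl.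
    have [a /[!in_itv]/= /andP[a1 a2]] := rat_in_itvoo xe.
    have [b /[!in_itv]/= /andP[b1 b2]] := rat_in_itvoo ex.
    exists (a, b); split => /=; first by rewrite a2 b1.
    move=> y /= /andP[ay yb]; apply: eP; rewrite /ball/= ltr_distlC.
    by rewrite (lt_trans a1 ay) (lt_trans yb b2).
  exists (finfun f) => //=; split=> [i _ /=|y By].
    by rewrite ffunE; have [] := fP i.
  apply: PU => i j; rewrite (ord1 i).
  by have [_] := fP j; apply; have := By j I; rewrite /= ffunE.
apply: countable_bigcupT_measurable; first exact: countableP.
move=> f; have [fU|nfU] := pselect (box f `<=` U); last first.
  by rewrite (_ : [set x | _] = set0)// -subset0 => x [_ /nfU].
rewrite (_ : [set x | _] = box f); last by apply/seteqP; split => [x []|].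
apply: fin_bigcap_measurable; first exact: finite_finset.
move=> i _; have mi : measurable `]ratr (f i).1 : R, ratr (f i).2[%classic.
  exact: measurable_itv.
have := measurable_coord i measurableT mi; rewrite setTI.
by congr measurable; apply/seteqP; split => x; rewrite /= in_itv.
Qed.

End measurable_rV.

Section euclidean.
Context {R : realType} {d : nat}.
Implicit Types x y : 'rV[R]_d.

Definition dotmul x y : R := \sum_(i < d) x ord0 i * y ord0 i.

(* Squared Euclidean norm; the library norm `|x| on 'rV is the sup norm. *)
Definition sqnorm x : R := dotmul x x.

End euclidean.

(* Lebesgue measure on R^d as the iterated integral of indicator functions,
   meaningful on measurable sets. *)
Fixpoint lebesgue_rV (R : realType) (d : nat) : set 'rV[R]_d -> \bar R :=
  match d with
  | 0 => fun A => (\1_A 0)%:E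
  | d'.+1 => fun A : set 'rV[R]_(1 + d') =>
      (\int[@lebesgue_measure R]_t
         lebesgue_rV [set y : 'rV[R]_d' | A (row_mx t%:M y)])%E
  end.

Record P2 (R : realType) (d : nat) := mkP2 {
  P2_prob :> probability 'rV[R]_d R ;
  P2_moment : (\int[P2_prob]_x (sqnorm x)%:E < +oo)%E }.

Section wasserstein.
Context {R : realType} {d : nat}.
Implicit Types (mu nu : P2 R d) (T : 'rV[R]_d -> 'rV[R]_d).
Local Open Scope ereal_scope.

(* Measures of the library are functions on all subsets, constrained only on
   the measurable ones, so equality of laws is tested on measurable sets. *)
Definition is_pushforward T mu nu : Prop :=
  measurable_fun setT T /\
  forall A, measurable A -> nu A = pushforward mu T A.

Definition coupling mu nu : set (probability ('rV[R]_d * 'rV[R]_d)%type R) :=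
  [set g | forall A, measurable A ->
     pushforward g fst A = mu A /\ pushforward g snd A = nu A].

Definition ot_cost mu nu : \bar R :=
  ereal_inf [set \int[g]_z (sqnorm (z.1 - z.2))%:E | g in coupling mu nu].

(* [ot_cost mu nu] is finite, so [fine] loses nothing. *)
Definition W2 mu nu : R := Num.sqrt (fine (ot_cost mu nu)).

Definition is_ot_map mu nu T : Prop :=
  is_pushforward T mu nu /\
  \int[mu]_x (sqnorm (T x - x))%:E = ot_cost mu nu.

Definition constant_speed_geodesic mu nu (lam : R -> P2 R d) : Prop :=
  [/\ lam 0%R = mu, lam 1%R = nu &
     forall s r : R, (0 <= s <= 1)%R -> (0 <= r <= 1)%R ->
       W2 (lam s) (lam r) = (`|s - r| * W2 mu nu)%R].

Definition sqL2 mu (xi : 'rV[R]_d -> 'rV[R]_d) : \bar R :=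
  \int[mu]_x (sqnorm (xi x))%:E.

Definition in_L2 mu (xi : 'rV[R]_d -> 'rV[R]_d) : Prop :=
  measurable_fun setT xi /\ sqL2 mu xi < +oo.

End wasserstein.

Section functionals.
Context {R : realType} {d : nat}.
Variable F : P2 R d -> \bar R.
Implicit Types (mu nu : P2 R d) (xi : 'rV[R]_d -> 'rV[R]_d).
Local Open Scope ereal_scope.

Definition proper_functional : Prop := exists mu, F mu < +oo.

(* Lower semicontinuity in the metric W2; as W2 vanishes between measures that
   agree on measurable sets, it forces F to take equal values on them. *)
Definition W2_lower_semicontinuous : Prop :=
  forall mu (a : R), a%:E < F mu ->
    exists2 e : R, (0 < e)%R &
      forall nu, (W2 mu nu < e)%R -> a%:E < F nu.

Definition geodesically_convex : Prop :=
  forall mu nu, exists2 lam : R -> P2 R d,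
    constant_speed_geodesic mu nu lam &
    forall s : R, (0 <= s <= 1)%R ->
      F (lam s) <= (1 - s)%:E * F mu + s%:E * F nu.

Definition is_minimizer (pi : P2 R d) : Prop := forall mu, F pi <= F mu.

Definition domain_absolutely_continuous : Prop :=
  forall mu, F mu < +oo -> mu `<< @lebesgue_rV R d.

(* The standing convention that optimal maps exist wherever they are written in
   the subdifferential; Brenier's theorem gives it on absolutely continuous
   domains. *)
Definition domain_has_ot_maps : Prop :=
  forall mu nu, F mu < +oo -> F nu < +oo -> exists T, is_ot_map mu nu T.

(* Optimal maps are unique mu-a.e. when mu is absolutely continuous, so the
   quantification over T ranges over versions of a single map. *)
Definition frechet_subdifferential mu : set ('rV[R]_d -> 'rV[R]_d) :=
  [set xi | [/\ F mu < +oo, in_L2 mu xi &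
     forall e : R, (0 < e)%R -> exists2 del : R, (0 < del)%R &
       forall nu T, F nu < +oo -> (W2 mu nu < del)%R -> is_ot_map mu nu T ->
         \int[mu]_x (dotmul (xi x) (T x - x))%:E - (e * W2 mu nu)%:E
           <= F nu - F mu]].

Definition is_W2_gradient mu xi : Prop :=
  frechet_subdifferential mu xi /\
  forall zeta, frechet_subdifferential mu zeta -> sqL2 mu xi <= sqL2 mu zeta.

End functionals.

Section iterates.
Context {R : realType} {d : nat}.
Variables (mu : nat -> P2 R d) (xi : nat -> 'rV[R]_d -> 'rV[R]_d).

Definition rbar (reps : R) (t : nat) : R :=
  Num.max reps (\big[Num.max/0]_(s < t.+1) W2 (mu 0%N) (mu s)).

Definition Gsum (t : nat) : R :=
  \sum_(s < t.+1) fine (sqL2 (mu s) (xi s)).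

Definition adaptive_step (reps : R) (t : nat) : R := rbar reps t / Num.sqrt (Gsum t).

Definition forward_euler (eta : nat -> R) : Prop :=
  forall t, is_pushforward (fun x => x - eta t *: xi t x) (mu t) (mu t.+1).

(* The value [mub 0] is irrelevant. *)
Definition uniform_averages (mub : nat -> P2 R d) : Prop :=
  (forall A, measurable A -> mub 1%N A = mu 0%N A) /\
  forall t, (1 <= t)%N -> exists2 T, is_ot_map (mub t) (mu t) T &
    is_pushforward (fun x => (1 - t.+1%:R^-1) *: x + t.+1%:R^-1 *: T x)
      (mub t) (mub t.+1).

End iterates.

Definition log_plus (R : realType) (x : R) : R := 1 + ln x.

(* Main.v *)
From HB Require Import structures.
Require Import Defs.
From mathcomp Require Import all_boot all_order all_algebra.
From mathcomp Require Import all_classical all_reals all_analysis.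
From mathcomp Require Import measurable_realfun ring lra.
Set Implicit Arguments.
Unset Strict Implicit.
Unset Printing Implicit Defensive.
Import Order.TTheory GRing.Theory Num.Theory.
Import numFieldNormedType.Exports.
Local Open Scope classical_set_scope.
Local Open Scope ring_scope.

(** Geodesic convexity upgrades the Fréchet subdifferential inequality to
  F(pi) - F(mu_t) >= <xi_t, t_{mu_t}^pi - id>, which with the coupling
  (id - eta_t xi_t, t_{mu_t}^pi) of mu_{t+1} and pi gives the usual descent
  inequality for W2(mu_t, pi)^2.  Multiplying it by rbar_t / eta_t = sqrt G_t and
  summing by parts bounds sum rbar_t (F(mu_t) - F(pi)); dividing by rbar_t,
  summing by parts once more, and using rbar_{t+1} <= 2 rbar_t costs the
  logarithm.  The average is controlled by convexity along the geodesic from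
  mub_t to mu_t.

  The geodesics provided by the convexity hypothesis are related to the given
  optimal maps by uniqueness of optimal maps from an absolutely continuous
  measure.  If T and T' are both optimal, exchanging the targets of the pairs
  (x, T x), (y, T' y) that violate <T x - T' y, x - y> >= 0 yields a coupling,
  so almost no pair violates it.  On a set where T_i >= a > b >= T'_i and T, T' are
  bounded, the support then meets every line parallel to the i-th axis at most
  once, hence is Lebesgue null. *)

(** * Lebesgue measure on R^d *)

Lemma measurable_fun_rV (dO : measure_display) (O : measurableType dO)
    (R : realType) (d : nat) (f : O -> 'rV[R]_d) :
  (forall i, measurable_fun setT (fun x => f x ord0 i)) ->
  measurable_fun setT f.
Proof.
move=> mf; apply: (@measurability _ _ _ _ _ _
  (\big[setU/set0]_(i < d) preimage_set_system setT
     (fun x : 'rV[R]_d => x ord0 i) measurable)) => //.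
move=> _ [B + <-]; rewrite -bigcup_seq => -[i _ [Y mY <-]].
by rewrite setTI; exact: mf.
Qed.

Lemma measurable_rV_coord (dO : measure_display) (O : measurableType dO)
    (R : realType) (d : nat) (f : O -> 'rV[R]_d) (i : 'I_d) :
  measurable_fun setT f -> measurable_fun setT (fun x => f x ord0 i).
Proof. by move=> mf; exact: (measurableT_comp (measurable_coord i) mf). Qed.

Lemma measurable_row_mx (R : realType) (d : nat) :
  measurable_fun setT (fun p : R * 'rV[R]_d => row_mx p.1%:M p.2 : 'rV[R]_(1 + d)).
Proof.
apply: measurable_fun_rV => i; have [j ->|j ->] := split_ordP i.
  under eq_fun do rewrite row_mxEl mxE !ord1 eqxx mulr1n.
  exact: measurable_fst.
under eq_fun do rewrite row_mxEr.
exact: (measurableT_comp (measurable_coord j) measurable_snd).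
Qed.

(** The measure structure of a pushforward depends on the measurability proof; the existential keeps
    that proof out of later rewriting. *)
Lemma measure_pushforward d1 d2 (T1 : measurableType d1)
    (T2 : measurableType d2) (R : realType)
  (m : {measure set T1 -> \bar R}) (f : T1 -> T2) : measurable_fun setT f ->
  exists m' : {measure set T2 -> \bar R}, m' = pushforward m f :> (set T2 -> \bar R).
Proof.
by move=> mf; pose g : {measure set T2 -> \bar R} := pushforward m f; exists (g mf).
Qed.

Lemma sigma_finite_measure_ex d (T : measurableType d) (R : realType)
    (m : {measure set T -> \bar R}) : sigma_finite setT m ->
  exists m' : {sigma_finite_measure set T -> \bar R},
    m' = m :> (set T -> \bar R).
Proof.
move=> sm; pose H1 := isSFinite.Build _ _ _ _ (sfinite_measure_sigma_finite sm).
pose H2 := isSigmaFinite.Build _ _ _ _ sm.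
by exists (HB.pack_for (SigmaFiniteMeasure.type T R) (Measure.sort m) H1 H2).
Qed.

(** [lebesgue_rV] is a recursive set function without measure structure. By induction it agrees on
    measurable sets with the image under [row_mx] of a product measure, so that Tonelli becomes
    available. *)
Lemma lebesgue_rV_measure (R : realType) (d : nat) :
  exists m : {sigma_finite_measure set 'rV[R]_d -> \bar R},
    forall A, measurable A -> m A = lebesgue_rV A.
Proof.
elim: d => [|d [m mE]].
  pose D := @dirac _ 'rV[R]_0 0 R.
  by exists D.
pose f := (fun p : measurableTypeR R * 'rV[R]_d => row_mx p.1%:M p.2 : 'rV[R]_(1 + d)).
have mf : measurable_fun setT f by exact: measurable_row_mx.
pose l : {sigma_finite_measure set (measurableTypeR R) -> \bar R} := @lebesgue_measure R.
pose lm : {measure set (measurableTypeR R * 'rV[R]_d)%type -> \bar R} := (l \x m)%E.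
have [pf pfE] := measure_pushforward lm mf.
have sf : sigma_finite setT pf.
  have /sigma_finiteP[F [TF ndF Foo]] := sigma_finiteT l.
  have /sigma_finiteP[G [TG ndG Goo]] := sigma_finiteT m.
  (* [g] is a measurable left inverse of [f]: rectangles exhausting the product pull back along [g]
     to an exhaustion by sets of finite [pf]-measure. *)
  pose g (x : 'rV[R]_(1 + d)) : measurableTypeR R * 'rV[R]_d :=
    (x ord0 (lshift d ord0), rsubmx x).
  have mg : measurable_fun setT g.
    apply/measurable_fun_pairP; split.
      exact: measurable_coord.
    apply: measurable_fun_rV => i /=.
    under eq_fun do rewrite mxE; exact: measurable_coord.
  have fK : cancel f g.
    by move=> [t y]; rewrite /g/f/= row_mxEl mxE eqxx row_mxKr.
  exists (fun n => g @^-1` (F n `*` G n)).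
    rewrite -preimage_bigcup (_ : \bigcup_n _ = setT) ?preimage_setT//.
    apply/seteqP; split=> // -[x y] _.
    have [n _ Fx] : (\bigcup_i F i) x by rewrite -TF.
    have [k _ Gy] : (\bigcup_i G i) y by rewrite -TG.
    exists (maxn n k) => //; split => /=.
      by move: x Fx; exact/subsetPset/ndF/leq_maxl.
    by move: y Gy; exact/subsetPset/ndG/leq_maxr.
  move=> n; have [mF Fn] := Foo n; have [mG Gn] := Goo n; split.
    by rewrite -[X in measurable X]setTI; apply: mg => //; exact: measurableX.
  rewrite pfE /pushforward/=.
  rewrite (_ : f @^-1` _ = F n `*` G n); last first.
    by apply/funext => z; exact: (congr1 (F n `*` G n) (fK z)).
  by rewrite /lm /= product_measure1E// lte_mul_pinfty// ge0_fin_numE.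
have [M ME] := sigma_finite_measure_ex sf.
exists M => A mA /=.
rewrite ME pfE /pushforward /product_measure1/=; apply: eq_integral => t _ /=.
rewrite -mE; last first.
  rewrite -[X in measurable X]setTI.
  have mt : measurable_fun setT (fun y : 'rV[R]_d => f (t, y)).
    exact: (measurableT_comp mf (measurable_pair1 t)).
  exact: mt.
congr (m _); apply/seteqP; split => y /=; by rewrite /xsection /= ?inE.
Qed.

(** If [i] is the first coordinate, Tonelli puts the integral along [i] innermost, over fibres with
    at most one point. Otherwise every slice at a fixed first coordinate has the same property in
    one dimension less. *)
Lemma lebesgue_rV_line (R : realType) (d : nat) (i : 'I_d) (E : set 'rV[R]_d) :
  measurable E ->
  (forall x y, E x -> E y ->
     (forall j, j != i -> x ord0 j = y ord0 j) -> x = y) ->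
  lebesgue_rV E = 0%E.
Proof.
elim: d i E => [|d IH] i E mE Ei; first by case: i Ei.
pose f := (fun p : measurableTypeR R * 'rV[R]_d =>
  row_mx p.1%:M p.2 : 'rV[R]_(1 + d)).
have mf : measurable_fun setT f by exact: measurable_row_mx.
have mf2 t : measurable_fun setT (fun y => f (t, y)).
  exact: (measurableT_comp mf (measurable_pair1 t)).
have mEt t : measurable [set y | E (f (t, y))].
  by rewrite -[X in measurable X]setTI; exact: mf2.
have fi t t' y y' : f (t, y) = f (t', y') -> t = t' /\ y = y'.
  move=> /eq_row_mx[tt yy]; split => //.
  by have := congr1 (fun M : 'M[R]_1 => M ord0 ord0) tt; rewrite !mxE eqxx.
have fr t y (k : 'I_d) : f (t, y) ord0 (rshift 1 k) = y ord0 k.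
  exact: row_mxEr.
have fl t y (k : 'I_1) : f (t, y) ord0 (lshift d k) = (t%:M : 'M[R]_1) ord0 k.
  exact: row_mxEl.
rewrite /lebesgue_rV -/lebesgue_rV.
have [j ij|j ij] := @split_ordP 1 d i.
  have [m mleb] := lebesgue_rV_measure R d.
  pose l : {sigma_finite_measure set (measurableTypeR R) -> \bar R} :=
    @lebesgue_measure R.
  have mA : measurable (f @^-1` E).
    by rewrite -[X in measurable X]setTI; exact: mf.
  transitivity (\int[l]_t (m \o xsection (f @^-1` E)) t)%E.
    apply: eq_integral => t _ /=; rewrite -mleb; last exact: mEt.
    by congr (m _); apply/seteqP; split => y; rewrite /xsection /= ?inE.
  have := indic_fubini_tonelli l m mA.
  rewrite (indic_fubini_tonelli_FE m mA) (indic_fubini_tonelli_GE l mA) => ->.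
  apply: integral0_eq => y _ /=; rewrite /ysection /=.
  set S := [set x | _].
  have [[t St]|nS] := pselect (exists t, S t).
    rewrite (_ : S = [set t]); first exact: lebesgue_measure_set1.
    apply/seteqP; split => [t' St'|_ ->//].
    move: St St'; rewrite /S /= !inE => St St'.
    apply: (proj1 (fi _ _ y y _)); apply: Ei => // k; rewrite ij => kj.
    have [k' kk|k' kk] := @split_ordP 1 d k.
      by move: kj; rewrite kk !ord1 eqxx.
    by rewrite kk; exact: (etrans (fr _ _ _) (esym (fr _ _ _))).
  rewrite (_ : S = set0) ?measure0//; apply/seteqP; split => // t St.
  by apply: nS; exists t.
apply: integral0_eq => t _; apply: (IH j); first exact: mEt.
move=> x y Ex Ey xy; apply: (proj2 (fi t t _ _ _)); apply: Ei => // k ki.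
have [k' kk|k' kk] := @split_ordP 1 d k.
  by rewrite kk; exact: (etrans (fl _ _ _) (esym (fl _ _ _))).
rewrite kk; apply: (etrans (fr _ _ _)); apply: (etrans _ (esym (fr _ _ _))).
apply: xy; apply: contraNneq ki.
by rewrite kk ij => ->.
Qed.

(** * Monotone pairs of maps on absolutely continuous measures *)

Lemma negligible_bigcup_count (d : measure_display) (O : measurableType d)
    (R : realType) (m : {measure set O -> \bar R}) (I : countType)
    (F : I -> set O) :
  (forall i, m.-negligible (F i)) -> m.-negligible (\bigcup_i F i).
Proof.
move=> nF.
apply: (@negligibleS _ _ _ _
  (\bigcup_n (if unpickle n is Some i then F i else set0))).
  by move=> x [i _ Fx]; exists (pickle i) => //; rewrite pickleK.
apply: negligible_bigcup => n; case: unpickle => [i|]; first exact: nF.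
exact: negligible_set0.
Qed.

Section rational_boxes.
Context {R : realType} {d : nat}.
Implicit Types (f : {ffun 'I_d -> rat * rat}) (x : 'rV[R]_d).

(** Finite functions into pairs of rationals form a countable index type, so all null boxes can be
    removed at once. *)
Definition rat_box f : set 'rV[R]_d :=
  \bigcap_i [set x | ratr (f i).1 < x ord0 i < ratr (f i).2].

Lemma measurable_rat_box f : measurable (rat_box f).
Proof.
apply: fin_bigcap_measurable; first exact: finite_finset.
move=> i _; have mi : measurable `]ratr (f i).1 : R, ratr (f i).2[%classic.
  exact: measurable_itv.
have := measurable_coord i measurableT mi; rewrite setTI.
by congr measurable; apply/seteqP; split => x; rewrite /= in_itv.
Qed.

Lemma nbhs_rat_box x (U : set 'rV[R]_d) : nbhs x U ->
  exists2 f, rat_box f x & rat_box f `<=` U.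
Proof.
move=> [P nP PU].
have /choice[f fP] : forall i : 'I_d, exists q : rat * rat,
    ratr q.1 < x ord0 i < ratr q.2 /\
    [set y : R | ratr q.1 < y < ratr q.2] `<=` P ord0 i.
  move=> i; have /nbhs_ballP[e /= e0 eP] := nP ord0 i.
  have xe : x ord0 i - e < x ord0 i by rewrite ltrBlDr ltrDl.
  have ex : x ord0 i < x ord0 i + e by rewrite ltrDl.
  have [a /[!in_itv]/= /andP[a1 a2]] := rat_in_itvoo xe.
  have [b /[!in_itv]/= /andP[b1 b2]] := rat_in_itvoo ex.
  exists (a, b); split => /=; first by rewrite a2 b1.
  move=> y /= /andP[ay yb]; apply: eP; rewrite /ball/= ltr_distlC.
  by rewrite (lt_trans a1 ay) (lt_trans yb b2).
exists (finfun f) => [i _ /=|y By]; first by rewrite ffunE; have [] := fP i.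
apply: PU => i j; rewrite (ord1 i).
by have [_] := fP j; apply; have := By j I; rewrite /= ffunE.
Qed.

End rational_boxes.

Lemma measurable_dotmul (dO : measure_display) (O : measurableType dO)
    (R : realType) (d : nat) (f g : O -> 'rV[R]_d) :
  measurable_fun setT f -> measurable_fun setT g ->
  measurable_fun setT (fun x => dotmul (f x) (g x)).
Proof.
move=> mf mg; apply: measurable_sum => i.
by apply: measurable_funM; exact: measurable_rV_coord.
Qed.

Lemma measurable_rVD (dO : measure_display) (O : measurableType dO)
    (R : realType) (d : nat) (f g : O -> 'rV[R]_d) :
  measurable_fun setT f -> measurable_fun setT g ->
  measurable_fun setT (fun x => f x + g x).
Proof.
move=> mf mg; apply: measurable_fun_rV => i; under eq_fun do rewrite mxE.
by apply: measurable_funD; exact: measurable_rV_coord.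
Qed.

Lemma measurable_rVZ (dO : measure_display) (O : measurableType dO)
    (R : realType) (d : nat) (c : R) (f : O -> 'rV[R]_d) :
  measurable_fun setT f -> measurable_fun setT (fun x => c *: f x).
Proof.
move=> mf; apply: measurable_fun_rV => i; under eq_fun do rewrite mxE.
by apply: measurable_funM; [exact: measurable_cst|exact: measurable_rV_coord].
Qed.

Lemma measurable_rVB (dO : measure_display) (O : measurableType dO)
    (R : realType) (d : nat) (f g : O -> 'rV[R]_d) :
  measurable_fun setT f -> measurable_fun setT g ->
  measurable_fun setT (fun x => f x - g x).
Proof.
move=> mf mg; under eq_fun do rewrite -scaleN1r.
by apply: measurable_rVD => //; exact: measurable_rVZ.
Qed.

Section strict_pairs.
Context {R : realType} {d : nat}.
Variables (m : probability 'rV[R]_d R) (T T' : 'rV[R]_d -> 'rV[R]_d).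
Hypotheses (m_ac : m `<< @lebesgue_rV R d)
  (mT : measurable_fun setT T) (mT' : measurable_fun setT T').
Hypothesis mono :
  (m \x m)%E [set z | dotmul (T z.1 - T' z.2) (z.1 - z.2) < 0] = 0%E.

(* On a line parallel to the i-th axis only the i-th coordinates of T and T'
   enter the monotonicity inequality, so two points of the support of m
   restricted to this set cannot lie on such a line. *)
Let slab (i : 'I_d) (a b N : R) : set 'rV[R]_d :=
  [set x | a <= T x ord0 i] `&` [set x | T' x ord0 i <= b] `&`
  \bigcap_(j in [set: 'I_d])
    ([set x | `|T x ord0 j| <= N] `&` [set x | `|T' x ord0 j| <= N]).

(** With [c = a - b] this dominates the monotonicity product on the slab once [z.2] exceeds [z.1] in
    coordinate [i]. Unlike that product, built from merely measurable maps, it is continuous in [z],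
    so its negativity is an open condition. *)
Let cone (i : 'I_d) (c N : R) (z : 'rV[R]_d * 'rV[R]_d) : R :=
  2 * N * (\sum_(j < d | j != i) `|z.1 ord0 j - z.2 ord0 j|)
  - c * (z.2 ord0 i - z.1 ord0 i).

Lemma slab_cone i a b N x y : b < a -> slab i a b N x -> slab i a b N y ->
  cone i (a - b) N (x, y) < 0 -> dotmul (T x - T' y) (x - y) < 0.
Proof.
move=> ba [[ax bx] Nx] [[ay by'] Ny]; rewrite /cone /= subr_lt0 => cxy.
rewrite /dotmul (bigD1 i)//= !mxE.
have N0 : 0 <= N by have [/= h _] := Nx i I; rewrite (le_trans _ h).
have S : \sum_(j < d | j != i) (T x - T' y) ord0 j * (x - y) ord0 j <=
    2 * N * (\sum_(j < d | j != i) `|x ord0 j - y ord0 j|).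
  rewrite mulr_sumr; apply: ler_sum => j _; rewrite !mxE.
  rewrite (le_trans (ler_norm _))// normrM ler_wpM2r//.
  have [/= hx _] := Nx j I; have [_ /= hy] := Ny j I.
  by rewrite (le_trans (ler_normB _ _))// mulr_natl mulr2n lerD.
have S0 : 0 <= 2 * N * (\sum_(j < d | j != i) `|x ord0 j - y ord0 j|).
  by rewrite !mulr_ge0// sumr_ge0.
move: S S0 cxy ax by' ba => /=; set A := (\sum_(_ < _ | _) (_ * _)).
set B := 2 * N * _ => S S0 cxy ax by' ba.
(* The off-axis term is nonnegative, so a negative [cone] forces [y] above [x] in coordinate [i]. *)
have yx : 0 < y ord0 i - x ord0 i.
  by rewrite -(pmulr_rgt0 _ (_ : 0 < a - b)) ?subr_gt0// (le_lt_trans S0).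
have : (a - b) * (y ord0 i - x ord0 i) <=
    (T x ord0 i - T' y ord0 i) * (y ord0 i - x ord0 i).
  by rewrite ler_pM2r// lerB.
move=> h; lra.
Qed.

Lemma measurable_slab i a b N : measurable (slab i a b N).
Proof.
have mc (f : 'rV[R]_d -> R) (D : set R) : measurable_fun setT f ->
    measurable D -> measurable (f @^-1` D).
  by move=> mf mD; rewrite -[X in measurable X]setTI; exact: mf.
have mn (f : 'rV[R]_d -> 'rV[R]_d) j : measurable_fun setT f ->
    measurable [set x | `|f x ord0 j| <= N].
  move=> mf; have mfj : measurable_fun setT (fun x => `|f x ord0 j|).
    by apply: measurableT_comp => //; exact: measurable_rV_coord.
  have := mc _ `]-oo, N]%classic mfj (measurable_itv _).
  by congr measurable; apply/seteqP; split => x; rewrite /= in_itv.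
apply: measurableI; first apply: measurableI.
- have := mc _ `[a, +oo[%classic (measurable_rV_coord i mT) (measurable_itv _).
  by congr measurable; apply/seteqP; split => x; rewrite /= in_itv/= andbT.
- have := mc _ `]-oo, b]%classic (measurable_rV_coord i mT') (measurable_itv _).
  by congr measurable; apply/seteqP; split => x; rewrite /= in_itv.
apply: fin_bigcap_measurable; first exact: finite_finset.
by move=> j _; apply: measurableI; exact: mn.
Qed.

Lemma cone_continuous i c N : continuous (cone i c N).
Proof.
have coordc j : continuous (fun x : 'rV[R]_d => x ord0 j).
  exact: coord_continuous.
have c1 j : continuous (fun z : 'rV[R]_d * 'rV[R]_d => z.1 ord0 j).
  move=> z; apply: (@continuous_comp _ _ _ fst (fun x : 'rV[R]_d => x ord0 j)).
    exact: cvg_fst.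
  exact: coordc.
have c2 j : continuous (fun z : 'rV[R]_d * 'rV[R]_d => z.2 ord0 j).
  move=> z; apply: (@continuous_comp _ _ _ snd (fun x : 'rV[R]_d => x ord0 j)).
    exact: cvg_snd.
  exact: coordc.
move=> z; apply: cvgB; apply: cvgM; do ?exact: cvg_cst.
  apply: (@continuous_big _ _ _ _ _ _ _ _
    (fun j (z : 'rV[R]_d * 'rV[R]_d) => `|z.1 ord0 j - z.2 ord0 j|)).
    by move=> [u v]; exact: add_continuous.
  by move=> j _ w; apply: cvg_norm; apply: cvgB; [exact: c1|exact: c2].
by apply: cvgB; [exact: c2|exact: c1].
Qed.

Lemma slab_null i a b N : b < a -> m.-negligible (slab i a b N).
Proof.
move=> ba; set S := slab i a b N.
have mS : measurable S by exact: measurable_slab.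
(* [G f] is the box if the slab has no mass in it. What remains of [S] outside all [G f] is its part
   in the support of [m] restricted to [S]. *)
pose G (f : {ffun 'I_d -> rat * rat}) : set 'rV[R]_d :=
  if m (S `&` rat_box f) == 0%E then rat_box f else set0.
have mG f : measurable (G f).
  by rewrite /G; case: ifP => _; [exact: measurable_rat_box|exact: measurable0].
have mUG : measurable (\bigcup_f G f).
  by apply: countable_bigcupT_measurable => //; exact: countableP.
have nSG : m.-negligible (\bigcup_f (S `&` G f)).
  apply: negligible_bigcup_count => f; apply/negligibleP.
    exact: measurableI.
  by rewrite /G; case: ifPn => [/eqP|_]; rewrite ?setI0 ?measure0.
suff nB : m.-negligible (S `\` \bigcup_f G f).
  apply: (negligibleS _ (negligibleU nSG nB)) => x Sx.
  have [[f _ Gx]|nG] := pselect ((\bigcup_f G f) x); last by right.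
  by left; exists f.
have mB : measurable (S `\` \bigcup_f G f) by exact: measurableD.
suff /m_ac nB : (@lebesgue_rV R d).-null_set (S `\` \bigcup_f G f).
  by apply/negligibleP => //; exact: nB.
have noline x y : (S `\` \bigcup_f G f) x -> (S `\` \bigcup_f G f) y ->
    (forall j, j != i -> x ord0 j = y ord0 j) -> ~ x ord0 i < y ord0 i.
  move=> [Sx nGx] [Sy nGy] xy lt.
  (* On a line parallel to the axis the off-axis term vanishes; by continuity [cone] then stays
     negative on a product of two rational boxes. *)
  have cxy : cone i (a - b) N (x, y) < 0.
    rewrite /cone /= big1 => [|j ji]; last by rewrite xy// subrr normr0.
    by rewrite mulr0 sub0r oppr_lt0 mulr_gt0// subr_gt0.
  have : \forall z \near (x, y), cone i (a - b) N z < 0.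
    exact: (cvgr_lt (cone i (a - b) N (x, y))
      (@cone_continuous i (a - b) N (x, y)) _ cxy).
  move=> -[[P Q] [/= /nbhs_rat_box[f fx fP] /nbhs_rat_box[g gy gQ]] PQ].
  have mSf h : measurable (S `&` rat_box h).
    by apply: measurableI => //; exact: measurable_rat_box.
  (* This product lies in the null set of [mono], so one factor is null and its box has already been
     removed. *)
  have : (m \x m)%E ((S `&` rat_box f) `*` (S `&` rat_box g)) = 0%E.
    apply/eqP; rewrite -measure_le0 -mono le_measure ?inE//.
    - exact: measurableX.
    - rewrite -[X in measurable X]setTI.
      pose h z := dotmul (T z.1 - T' z.2) (z.1 - z.2).
      have mh : measurable_fun setT h.
        apply: measurable_dotmul; apply: measurable_rVB.
        + exact: measurableT_comp mT measurable_fst.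
        + exact: measurableT_comp mT' measurable_snd.
        + exact: measurable_fst.
        + exact: measurable_snd.
      have := mh measurableT `]-oo, 0[%classic (measurable_itv _).
      by congr measurable; apply/seteqP; split => z; rewrite /= in_itv.
    - move=> [u v] [/= [Su fu] [Sv gv]].
      apply: (@slab_cone i a b N) => //; apply: (PQ (u, v)).
      by split; [exact: fP|exact: gQ].
  rewrite product_measure1E//= => /eqP; rewrite mule_eq0 => /orP[] e0.
    by apply: nGx; exists f => //; rewrite /G e0.
  by apply: nGy; exists g => //; rewrite /G e0.
move=> C mC CB; apply: (@lebesgue_rV_line _ _ i) => // x y /CB Bx /CB By xy.
apply/rowP => j; have [->|ji] := eqVneq j i; last exact: xy.
apply/eqP; rewrite eq_le; apply/andP; split; rewrite leNgt; apply/negP.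
  by apply: noline => // k ki; rewrite xy.
exact: noline.
Qed.

(** Two rationals separate the [i]-th coordinates and an integer bounds all coordinates, so
    countably many slabs cover the set. *)
Lemma monotone_le_ae i : m.-negligible [set x | T' x ord0 i < T x ord0 i].
Proof.
pose F (p : rat * rat * nat) : set 'rV[R]_d :=
  if p.1.2 < p.1.1 then slab i (ratr p.1.1) (ratr p.1.2) p.2%:R else set0.
apply: (@negligibleS _ _ _ _ (\bigcup_p F p)); last first.
  apply: negligible_bigcup_count => p; rewrite /F; case: ifPn => [lt|_].
    by apply: slab_null; rewrite ltr_rat.
  exact: negligible_set0.
move=> x /= lt.
have [a /[!in_itv]/= /andP[a1 a2]] := rat_in_itvoo lt.
have [b /[!in_itv]/= /andP[b1 b2]] := rat_in_itvoo a1.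
pose B := \sum_j (`|T x ord0 j| + `|T' x ord0 j|).
have B0 : 0 <= B by apply: sumr_ge0 => j _; rewrite addr_ge0.
have Bj j : `|T x ord0 j| + `|T' x ord0 j| <= B.
  by rewrite /B (bigD1 j)//= lerDl sumr_ge0// => k _; rewrite addr_ge0.
exists (a, b, Num.truncn B + 1)%N => //.
rewrite /F /= -(ltr_rat R) b2; split; first by split; exact: ltW.
have BN : B <= (Num.truncn B + 1)%:R by rewrite addn1 ltW// truncnS_gt.
move=> j _; split => /=; rewrite (le_trans _ BN)// (le_trans _ (Bj j))//.
  by rewrite lerDl.
by rewrite lerDr.
Qed.

End strict_pairs.

(** * Square-integrable vector fields *)

Section dotmul_theory.
Context {R : realType} {d : nat}.
Implicit Types x y z : 'rV[R]_d.

Lemma dotmulC x y : dotmul x y = dotmul y x.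
Proof. by apply: eq_bigr => i _; rewrite mulrC. Qed.

Lemma dotmulDl x y z : dotmul (x + y) z = dotmul x z + dotmul y z.
Proof. by rewrite -big_split; apply: eq_bigr => i _; rewrite mxE mulrDl. Qed.

Lemma dotmulZl a x y : dotmul (a *: x) y = a * dotmul x y.
Proof. by rewrite mulr_sumr; apply: eq_bigr => i _; rewrite mxE mulrA. Qed.

Lemma dotmulDr x y z : dotmul x (y + z) = dotmul x y + dotmul x z.
Proof. by rewrite dotmulC dotmulDl !(dotmulC x). Qed.

Lemma dotmulZr a x y : dotmul x (a *: y) = a * dotmul x y.
Proof. by rewrite dotmulC dotmulZl dotmulC. Qed.

Lemma dotmulNl x y : dotmul (- x) y = - dotmul x y.
Proof. by rewrite -scaleN1r dotmulZl mulN1r. Qed.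

Lemma dotmulNr x y : dotmul x (- y) = - dotmul x y.
Proof. by rewrite dotmulC dotmulNl dotmulC. Qed.

Lemma sqnorm_ge0 x : 0 <= sqnorm x.
Proof. by apply: sumr_ge0 => i _; rewrite -expr2 sqr_ge0. Qed.

Lemma sqnorm_eq0 x : (sqnorm x == 0) = (x == 0).
Proof.
apply/eqP/eqP => [/eqP|->].
  rewrite psumr_eq0 => [/allP x0|i _]; last by rewrite -expr2 sqr_ge0.
  apply/rowP => i; rewrite mxE; apply/eqP.
  by have := x0 i (mem_index_enum _); rewrite mulf_eq0 orbb.
by rewrite /sqnorm -(scale0r 0) dotmulZl mul0r.
Qed.

End dotmul_theory.

Definition dotmulE :=
  (@dotmulDl, @dotmulDr, @dotmulZl, @dotmulZr, @dotmulNl, @dotmulNr).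

(** Expand [sqnorm (x + y)] and [sqnorm (x - y)], both nonnegative. The bound serves to make inner
    products of [L2] fields integrable. *)
Lemma dotmul_young (R : realType) (d : nat) (x y : 'rV[R]_d) :
  `|dotmul x y| <= sqnorm x + sqnorm y.
Proof.
have p : 0 <= sqnorm (x + y) by exact: sqnorm_ge0.
have q : 0 <= sqnorm (x - y) by exact: sqnorm_ge0.
have x0 := sqnorm_ge0 x; have y0 := sqnorm_ge0 y.
move: p q x0 y0; rewrite /sqnorm !dotmulE (dotmulC y x) => *.
by rewrite ler_norml; lra.
Qed.

Lemma measurable_sqnorm (dO : measure_display) (O : measurableType dO)
    (R : realType) (d : nat) (f : O -> 'rV[R]_d) :
  measurable_fun setT f -> measurable_fun setT (fun x => sqnorm (f x)).
Proof. by move=> mf; exact: measurable_dotmul. Qed.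

Section L2_space.
Context {dO : measure_display} {O : measurableType dO} {R : realType}.
Variable (P : probability O R).
Context {d : nat}.
Implicit Types f g h : O -> 'rV[R]_d.

Definition L2 f : Prop :=
  measurable_fun setT f /\ (\int[P]_x (sqnorm (f x))%:E < +oo)%E.

Definition ip f g : R := \int[P]_x dotmul (f x) (g x).

Lemma L2_integrable_sqnorm f : L2 f ->
  P.-integrable setT (EFin \o (fun x => sqnorm (f x))).
Proof.
move=> [mf f2]; apply/integrableP; split.
  exact/measurable_EFinP/measurable_sqnorm.
by under eq_integral do rewrite /= ger0_norm ?sqnorm_ge0//.
Qed.

Lemma L2_integrable_dotmul f g : L2 f -> L2 g ->
  P.-integrable setT (EFin \o (fun x => dotmul (f x) (g x))).
Proof.
move=> Lf Lg.
apply: (le_integrable measurableT _ _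
  (integrableD measurableT (L2_integrable_sqnorm Lf) (L2_integrable_sqnorm Lg))).
  by apply/measurable_EFinP/measurable_dotmul; [exact: Lf.1|exact: Lg.1].
move=> x _ /=; rewrite lee_fin [leRHS]ger0_norm ?dotmul_young//.
by rewrite addr_ge0 ?sqnorm_ge0.
Qed.

Lemma L2P f : measurable_fun setT f ->
  P.-integrable setT (EFin \o (fun x => sqnorm (f x))) -> L2 f.
Proof.
move=> mf /integrableP[_ fi]; split => //; apply: le_lt_trans fi.
by under [leRHS]eq_integral do rewrite /= ger0_norm ?sqnorm_ge0//.
Qed.

Lemma L2Z a f : L2 f -> L2 (fun x => a *: f x).
Proof.
move=> Lf; apply: L2P; first by apply: measurable_rVZ; exact: Lf.1.
rewrite (_ : EFin \o _ =
    (fun x => (a ^+ 2)%:E * (EFin \o (fun x => sqnorm (f x))) x)%E).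
  by apply: integrableZl => //; exact: L2_integrable_sqnorm.
by apply/funext => x /=; rewrite /sqnorm !dotmulE -EFinM mulrA.
Qed.

Lemma L2D f g : L2 f -> L2 g -> L2 (fun x => f x + g x).
Proof.
move=> Lf Lg; apply: L2P.
  by apply: measurable_rVD; [exact: Lf.1|exact: Lg.1].
rewrite (_ : EFin \o _ = (EFin \o (fun x => sqnorm (f x))) \+
  (EFin \o (fun x => sqnorm (g x))) \+
  (fun x => 2%:E * (EFin \o (fun x => dotmul (f x) (g x))) x)%E)%E; last first.
  apply/funext => x /=; rewrite /sqnorm !dotmulE (dotmulC (g x)) -EFinM -!EFinD.
  by congr EFin; ring.
apply: integrableD => //; last exact/integrableZl/L2_integrable_dotmul.
by apply: integrableD => //; exact: L2_integrable_sqnorm.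
Qed.

Lemma L2B f g : L2 f -> L2 g -> L2 (fun x => f x - g x).
Proof.
move=> Lf Lg; have := L2D Lf (L2Z (-1) Lg).
by congr L2; apply/funext => x; rewrite scaleN1r.
Qed.

Lemma integral_sqnormE f : L2 f -> (\int[P]_x (sqnorm (f x))%:E = (ip f f)%:E)%E.
Proof.
move=> Lf; rewrite /ip /Rintegral fineK//.
by apply: integrable_fin_num => //; exact: L2_integrable_sqnorm.
Qed.

Lemma integral_dotmulE f g : L2 f -> L2 g ->
  (\int[P]_x (dotmul (f x) (g x))%:E = (ip f g)%:E)%E.
Proof.
move=> Lf Lg; rewrite /ip /Rintegral fineK//.
by apply: integrable_fin_num => //; exact: L2_integrable_dotmul.
Qed.

Lemma ipC f g : ip f g = ip g f.
Proof. by apply: eq_Rintegral => x _; rewrite dotmulC. Qed.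

Lemma ipDl f g h : L2 f -> L2 g -> L2 h ->
  ip (fun x => f x + g x) h = ip f h + ip g h.
Proof.
move=> Lf Lg Lh; rewrite -RintegralD//; try exact: L2_integrable_dotmul.
by apply: eq_Rintegral => x _; rewrite dotmulDl.
Qed.

Lemma ipZl a f h : L2 f -> L2 h -> ip (fun x => a *: f x) h = a * ip f h.
Proof.
move=> Lf Lh; rewrite -RintegralZl//; try exact: L2_integrable_dotmul.
by apply: eq_Rintegral => x _; rewrite dotmulZl.
Qed.

Lemma ip_ge0 f : 0 <= ip f f.
Proof. by apply: Rintegral_ge0 => x _; exact: sqnorm_ge0. Qed.

Lemma ipDD f g : L2 f -> L2 g ->
  ip (fun x => f x + g x) (fun x => f x + g x) = ip f f + 2 * ip f g + ip g g.
Proof.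
move=> Lf Lg; have Lfg := L2D Lf Lg.
by rewrite ipDl// !(ipC _ (fun x => f x + g x)) !ipDl// (ipC g f); ring.
Qed.

Lemma ip_eq0_ae f : L2 f -> ip f f = 0 -> {ae P, forall x, f x = 0}.
Proof.
move=> Lf f0.
have : (\int[P]_x `|(sqnorm (f x))%:E| = 0)%E.
  under eq_integral do rewrite /= ger0_norm ?sqnorm_ge0//.
  by rewrite integral_sqnormE// f0.
move/(ae_eq_integral_abs P measurableT).
have mf : measurable_fun setT (fun x => (sqnorm (f x))%:E).
  by apply/measurable_EFinP/measurable_sqnorm; exact: Lf.1.
move=> /(_ mf); apply: filterS => x /(_ I)/= [] /eqP.
by rewrite sqnorm_eq0 => /eqP.
Qed.

End L2_space.

(** * Couplings and uniqueness of optimal maps *)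

(** Change of variables when the law of [f] is known only on measurable sets: the integral against
    [Q] is first moved to the pushforward measure itself. *)
Lemma ge0_integral_law (d1 d2 : measure_display) (X : measurableType d1)
    (Y : measurableType d2) (R : realType) (P : {measure set X -> \bar R})
    (Q : {measure set Y -> \bar R}) (f : X -> Y) (phi : Y -> \bar R) :
  measurable_fun setT f ->
  (forall A, measurable A -> Q A = pushforward P f A) ->
  measurable_fun setT phi -> (forall y, 0 <= phi y)%E ->
  (\int[Q]_y phi y = \int[P]_x phi (f x))%E.
Proof.
move=> mf QP mphi phi0; have [P' P'E] := measure_pushforward P mf.
rewrite (@eq_measure_integral _ _ _ setT P') => [|A mA _]; last by rewrite P'E QP.
by rewrite P'E ge0_integral_pushforward.
Qed.

Section couplings.
Context {R : realType} {d : nat}.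
Implicit Types mu nu : P2 R d.

Lemma L2_id mu : L2 mu (fun x => x).
Proof. by split; [exact: measurable_id|exact: P2_moment]. Qed.

Lemma ot_cost_ge0 mu nu : (0 <= ot_cost mu nu)%E.
Proof.
apply: le_ereal_inf_tmp => _ [g _ <-]; apply: integral_ge0 => z _.
by rewrite lee_fin sqnorm_ge0.
Qed.

(** The equal mixture of the laws of [h1] and [h2] is a coupling as soon as their marginals are
    right in sum; neither law has to be a coupling alone. The exchange of targets in
    [ot_map_monotone] has this form. *)
Lemma ot_cost_le_mixture (dO : measure_display) (O : measurableType dO)
    (P : probability O R) (h1 h2 : O -> 'rV[R]_d * 'rV[R]_d) mu nu :
  measurable_fun setT h1 -> measurable_fun setT h2 ->
  (forall A, measurable A ->
    P (h1 @^-1` (fst @^-1` A)) + P (h2 @^-1` (fst @^-1` A)) = mu A + mu A)%E ->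
  (forall A, measurable A ->
    P (h1 @^-1` (snd @^-1` A)) + P (h2 @^-1` (snd @^-1` A)) = nu A + nu A)%E ->
  (ot_cost mu nu + ot_cost mu nu <=
   \int[P]_w (sqnorm ((h1 w).1 - (h1 w).2))%:E +
   \int[P]_w (sqnorm ((h2 w).1 - (h2 w).2))%:E)%E.
Proof.
move=> mh1 mh2 h_mu h_nu.
have [Q1 Q1E] := measure_pushforward P mh1.
have [Q2 Q2E] := measure_pushforward P mh2.
have k0 : (0 <= 2^-1 :> R) by rewrite invr_ge0.
pose k : {nonneg R} := NngNum k0.
pose g : {measure set _ -> \bar R} := mscale k (measure_add Q1 Q2).
have gE B : g B = ((2^-1)%:E * (P (h1 @^-1` B) + P (h2 @^-1` B)))%E.
  transitivity ((2^-1)%:E * measure_add Q1 Q2 B)%E => //.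
  by rewrite measure_addE Q1E Q2E.
have half (a : \bar R) : ((2^-1)%:E * (a + a) = a)%E.
  by rewrite -mule2n -mule_natl muleA -EFinM mulVf ?mul1e.
have gT : g setT = 1%E by rewrite gE !preimage_setT !probability_setT half.
pose G : probability ('rV[R]_d * 'rV[R]_d)%type R :=
  HB.pack_for (probability ('rV[R]_d * 'rV[R]_d)%type R) (Measure.sort g)
    (Measure_isProbability.Build _ _ _ _ gT).
have cG : coupling mu nu G.
  by move=> A mA; rewrite /pushforward !gE h_mu// h_nu// !half.
have mc : measurable_fun setT
    (fun z : 'rV[R]_d * 'rV[R]_d => (sqnorm (z.1 - z.2))%:E).
  apply/measurable_EFinP/measurable_sqnorm/measurable_rVB.
    exact: measurable_fst.
  exact: measurable_snd.
have c0 (z : 'rV[R]_d * 'rV[R]_d) : (0 <= (sqnorm (z.1 - z.2))%:E)%E.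
  by rewrite lee_fin sqnorm_ge0.
have ecost : (ot_cost mu nu <= \int[G]_z (sqnorm (z.1 - z.2))%:E)%E.
  by apply: ereal_inf_lbound; exists G.
have iG : (\int[G]_z (sqnorm (z.1 - z.2))%:E =
  (2^-1)%:E * (\int[P]_w (sqnorm ((h1 w).1 - (h1 w).2))%:E +
   \int[P]_w (sqnorm ((h2 w).1 - (h2 w).2))%:E))%E.
  rewrite [LHS](@ge0_integral_mscale _ _ _ _ _ _ k)//.
  rewrite ge0_integral_measure_add//; congr (_ * (_ + _))%E.
    by rewrite Q1E ge0_integral_pushforward.
  by rewrite Q2E ge0_integral_pushforward.
rewrite (le_trans (leeD ecost ecost))// iG; set S := (X in (_ * X + _)%E).
by rewrite -ge0_muleDr ?half// /S adde_ge0// integral_ge0.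
Qed.
Lemma is_pushforward_L2 T mu nu : is_pushforward T mu nu -> L2 mu T.
Proof.
move=> [mT TE]; split=> //.
rewrite -(@ge0_integral_law _ _ _ _ _ mu nu T (fun y => (sqnorm y)%:E))//.
- exact: P2_moment.
- by apply/measurable_EFinP/measurable_sqnorm; exact: measurable_id.
- by move=> y; rewrite lee_fin sqnorm_ge0.
Qed.

Lemma is_pushforward_comp T S mu nu rho : is_pushforward T mu nu ->
  is_pushforward S nu rho -> is_pushforward (S \o T) mu rho.
Proof.
move=> [mT TE] [mS SE]; split; first exact: measurableT_comp.
move=> A mA; rewrite SE// /pushforward TE//.
by rewrite -[X in measurable X]setTI; exact: mS.
Qed.

Lemma is_pushforward_ip T mu nu (f : 'rV[R]_d -> 'rV[R]_d) :
  is_pushforward T mu nu -> measurable_fun setT f ->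
  ip mu (f \o T) (f \o T) = ip nu f f.
Proof.
move=> [mT TE] mf; congr fine.
rewrite (@ge0_integral_law _ _ _ _ _ mu nu T (fun y => (sqnorm (f y))%:E))//.
- by apply/measurable_EFinP/measurable_sqnorm.
- by move=> y; rewrite lee_fin sqnorm_ge0.
Qed.

(** The joint law of [f] and [g] is a coupling; this is the mixture bound with [h1 = h2]. *)
Lemma ot_cost_le_ip f g m mu nu : is_pushforward f m mu ->
  is_pushforward g m nu ->
  (ot_cost mu nu <= (ip m (fun x => f x - g x) (fun x => f x - g x))%:E)%E.
Proof.
move=> fmu gnu; have Lf := is_pushforward_L2 fmu.
have Lg := is_pushforward_L2 gnu; rewrite -integral_sqnormE; last exact: L2B.
have [mf fE] := fmu; have [mg gE] := gnu.
have mh : measurable_fun setT (fun x => (f x, g x)).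
  exact: measurable_fun_pair.
have : (ot_cost mu nu + ot_cost mu nu <=
   \int[m]_x (sqnorm (f x - g x))%:E + \int[m]_x (sqnorm (f x - g x))%:E)%E.
  apply: (ot_cost_le_mixture (h1 := fun x => (f x, g x))
    (h2 := fun x => (f x, g x))) => // A mA.
    by rewrite fE.
  by rewrite gE.
by rewrite -!mule2n -!mule_natl lee_pmul2l.
Qed.

Lemma is_ot_mapP mu nu T : is_ot_map mu nu T ->
  ot_cost mu nu = (ip mu (fun x => T x - x) (fun x => T x - x))%:E.
Proof.
move=> [TE <-]; rewrite integral_sqnormE//.
by apply: L2B; [exact: is_pushforward_L2 TE|exact: L2_id].
Qed.

Lemma ot_map_L2 mu nu T : is_ot_map mu nu T -> L2 mu (fun x => T x - x).
Proof.
by move=> [TE _]; apply: L2B; [exact: is_pushforward_L2 TE|exact: L2_id].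
Qed.

(** Draw the two sources independently and exchange their targets on the violating set [S]. The
    summed marginals persist and the summed cost drops strictly on [S], so optimality makes [S]
    null. *)
Lemma ot_map_monotone mu nu T T' : is_ot_map mu nu T -> is_ot_map mu nu T' ->
  (mu \x mu)%E [set z | dotmul (T z.1 - T' z.2) (z.1 - z.2) < 0] = 0%E.
Proof.
move=> oT oT'; have [[mT TE] _] := oT; have [[mT' T'E] _] := oT'.
pose P : probability ('rV[R]_d * 'rV[R]_d)%type R := (mu \x mu)%E.
set S := [set z | _].
pose h z := dotmul (T z.1 - T' z.2) (z.1 - z.2).
have mT1 : measurable_fun setT (fun z : 'rV[R]_d * 'rV[R]_d => T z.1).
  exact: measurableT_comp mT measurable_fst.
have mT2 : measurable_fun setT (fun z : 'rV[R]_d * 'rV[R]_d => T' z.2).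
  exact: measurableT_comp mT' measurable_snd.
have mh : measurable_fun setT h.
  by apply: measurable_dotmul; apply: measurable_rVB.
have mS : measurable S.
  have := mh measurableT `]-oo, 0[%classic (measurable_itv _).
  by rewrite setTI; congr measurable; apply/seteqP; split => z; rewrite /= in_itv.
pose h1 z := (z.1, if h z < 0 then T' z.2 else T z.1).
pose h2 z := (z.2, if h z < 0 then T z.1 else T' z.2).
have mhb : measurable_fun setT (fun z => h z < 0).
  exact: measurable_fun_ltr.
have mh1 : measurable_fun setT h1.
  by apply: measurable_fun_pair => //; exact: measurable_fun_ifT.
have mh2 : measurable_fun setT h2.
  by apply: measurable_fun_pair => //; exact: measurable_fun_ifT.
have P1 A : measurable A -> P (fst @^-1` A) = mu A.
  move=> mA; rewrite (_ : _ @^-1` _ = A `*` setT); last first.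
    by apply/seteqP; split => -[x y] //= [].
  by rewrite [LHS]product_measure1E//= probability_setT mule1.
have P2 A : measurable A -> P (snd @^-1` A) = mu A.
  move=> mA; rewrite (_ : _ @^-1` _ = setT `*` A); last first.
    by apply/seteqP; split => -[x y] //= [].
  by rewrite [LHS]product_measure1E//= probability_setT mul1e.
have PU A : measurable A -> P ((fun z => T z.1) @^-1` A) = nu A.
  move=> mA; rewrite TE// /pushforward -P1//.
  by rewrite -[X in measurable X]setTI; exact: mT.
have PV A : measurable A -> P ((fun z => T' z.2) @^-1` A) = nu A.
  move=> mA; rewrite T'E// /pushforward -P2//.
  by rewrite -[X in measurable X]setTI; exact: mT'.
have split_S X : measurable X -> P X = (P (X `&` S) + P (X `\` S))%E.
  move=> mX; rewrite -measureU//; last 3 first.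
  - exact: measurableI.
  - exact: measurableD.
  - by apply/seteqP; split => // z [[_ ?] []].
  by rewrite setUIDK.
have cost : (ot_cost mu nu + ot_cost mu nu <=
    \int[P]_w (sqnorm ((h1 w).1 - (h1 w).2))%:E +
    \int[P]_w (sqnorm ((h2 w).1 - (h2 w).2))%:E)%E.
  apply: ot_cost_le_mixture => // A mA.
    by rewrite -{1}(P1 A mA) -(P2 A mA).
  have mpre (k : 'rV[R]_d * 'rV[R]_d -> 'rV[R]_d) : measurable_fun setT k ->
      measurable (k @^-1` A).
    by move=> mk; rewrite -[X in measurable X]setTI; exact: mk.
  have mU := mpre _ mT1; have mV := mpre _ mT2.
  have mW1 : measurable (h1 @^-1` (snd @^-1` A)).
    by apply: (mpre (snd \o h1)); exact: measurableT_comp.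
  have mW2 : measurable (h2 @^-1` (snd @^-1` A)).
    by apply: (mpre (snd \o h2)); exact: measurableT_comp.
  (* On [S] the two target maps trade places and off [S] they are unchanged, so the four pieces are
     a rearrangement of those for [T] and [T']. *)
  rewrite (split_S _ mW1) (split_S _ mW2).
  rewrite -{1}(PU A mA) -(PV A mA).
  rewrite (split_S _ mU) (split_S _ mV).
  rewrite (_ : _ `&` S = (fun z => T' z.2) @^-1` A `&` S); last first.
    by apply/seteqP; split => z [] /=; rewrite /h1 /S /= /h => + zS; rewrite zS.
  rewrite (_ : h2 @^-1` _ `&` S = (fun z => T z.1) @^-1` A `&` S); last first.
    by apply/seteqP; split => z [] /=; rewrite /h2 /S /= /h => + zS; rewrite zS.
  rewrite (_ : h1 @^-1` _ `\` S = (fun z => T z.1) @^-1` A `\` S); last first.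
    by apply/seteqP; split => z [] /=; rewrite /h1 /S /= /h => + /negP/negbTE zS;
      rewrite zS.
  rewrite (_ : h2 @^-1` _ `\` S = (fun z => T' z.2) @^-1` A `\` S); last first.
    by apply/seteqP; split => z [] /=; rewrite /h2 /S /= /h => + /negP/negbTE zS;
      rewrite zS.
  by rewrite addeACA [X in (X + _)%E]addeC addeACA.
(* [del] is the pointwise saving: expanding the squares before and after the exchange leaves exactly
   [- 2 h]. *)
pose del z := if h z < 0 then - (2 * h z) else 0.
have del0 z : 0 <= del z.
  by rewrite /del; case: ifP => // hz; rewrite oppr_ge0 pmulr_rle0// ltW.
have mdel : measurable_fun setT del.
  apply: measurable_fun_ifT => //; apply: measurableT_comp => //.
  exact: measurable_funM.
have swap z : sqnorm ((h1 z).1 - (h1 z).2) + sqnorm ((h2 z).1 - (h2 z).2) +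
    del z = sqnorm (T z.1 - z.1) + sqnorm (T' z.2 - z.2).
  rewrite /h1 /h2 /del /=; case: ifP => _; rewrite /h /sqnorm !dotmulE.
    by rewrite (dotmulC z.1 (T _)) (dotmulC z.1 (T' _))
      (dotmulC z.2 (T _)) (dotmulC z.2 (T' _)); ring.
  by rewrite (dotmulC z.1 (T _)) (dotmulC z.2 (T' _)); ring.
have c0 (u : 'rV[R]_d) : (0 <= (sqnorm u)%:E)%E by rewrite lee_fin sqnorm_ge0.
have mc (k l : 'rV[R]_d * 'rV[R]_d -> 'rV[R]_d) : measurable_fun setT k ->
    measurable_fun setT l -> measurable_fun setT (fun z => (sqnorm (k z - l z))%:E).
  by move=> mk ml; apply/measurable_EFinP/measurable_sqnorm/measurable_rVB.
have mh1c : measurable_fun setT (fun z => (sqnorm ((h1 z).1 - (h1 z).2))%:E).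
  by apply: mc; exact: measurableT_comp.
have mh2c : measurable_fun setT (fun z => (sqnorm ((h2 z).1 - (h2 z).2))%:E).
  by apply: mc; exact: measurableT_comp.
(* The exchanged cost is at least twice the optimal cost and, together with the integral of [del],
   equals it. Finiteness allows cancellation. *)
have id0 : (\int[P]_z (del z)%:E = 0)%E.
  have e : (\int[P]_z (sqnorm ((h1 z).1 - (h1 z).2))%:E +
      \int[P]_z (sqnorm ((h2 z).1 - (h2 z).2))%:E + \int[P]_z (del z)%:E =
      ot_cost mu nu + ot_cost mu nu)%E.
    rewrite -!ge0_integralD//; last 4 first.
    - by move=> z _; rewrite adde_ge0.
    - exact: emeasurable_funD.
    - by move=> z _; rewrite lee_fin.
    - exact/measurable_EFinP.
    under eq_integral do rewrite -!EFinD swap EFinD.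
    rewrite ge0_integralD//; [|exact: mc|exact: mc].
    have mTi : measurable_fun setT (fun x => (sqnorm (T x - x))%:E).
      by apply/measurable_EFinP/measurable_sqnorm/measurable_rVB.
    have mTi' : measurable_fun setT (fun x => (sqnorm (T' x - x))%:E).
      by apply/measurable_EFinP/measurable_sqnorm/measurable_rVB.
    congr (_ + _)%E.
      rewrite -oT.2 (@ge0_integral_law _ _ _ _ _ P mu fst
        (fun x => (sqnorm (T x - x))%:E))//.
      by move=> A mA; exact/esym/P1.
    rewrite -oT'.2 (@ge0_integral_law _ _ _ _ _ P mu snd
      (fun x => (sqnorm (T' x - x))%:E))//.
    by move=> A mA; exact/esym/P2.
  apply/eqP; rewrite eq_le integral_ge0 ?andbT; last by move=> z _; rewrite lee_fin.
  have fin : (ot_cost mu nu + ot_cost mu nu)%E \is a fin_num.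
    by rewrite (is_ot_mapP oT).
  move: cost; rewrite -e.
  set b := (\int[P]_z (del z)%:E)%E; set a := (X in (_ <= X)%E) => ab.
  have b0 : (0 <= b)%E by apply: integral_ge0 => z _; rewrite lee_fin.
  have a0 : (0 <= a)%E by rewrite adde_ge0// integral_ge0.
  move: fin; rewrite -e -/a -/b fin_numD => /andP[fa fb].
  by move: ab; rewrite -[leRHS]adde0 leeD2lE.
have : (\int[P]_z `|(del z)%:E| = 0)%E.
  by under eq_integral do rewrite /= ger0_norm//.
have mdelE : measurable_fun setT (fun z => (del z)%:E) by exact/measurable_EFinP.
move=> /(ae_eq_integral_abs P measurableT mdelE) ae0.
have /negligibleP : P.-negligible S; last exact.
apply: negligibleS ae0 => z Sz /= /(_ I) [].
rewrite /del ifT// => /eqP; rewrite oppr_eq0 mulf_eq0 pnatr_eq0/= => /eqP h0.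
by move: Sz; rewrite /S /= -/(h z) h0 ltxx.
Qed.

(** The roles of [T] and [T'] can be interchanged, so both inequalities hold almost everywhere in
    each of the finitely many coordinates. *)
Lemma ot_map_unique mu nu T T' : mu `<< @lebesgue_rV R d ->
  is_ot_map mu nu T -> is_ot_map mu nu T' -> {ae mu, forall x, T x = T' x}.
Proof.
move=> ac oT oT'; have [[mT _] _] := oT; have [[mT' _] _] := oT'.
have le i := monotone_le_ae ac mT mT' (ot_map_monotone oT oT') i.
have ge i := monotone_le_ae ac mT' mT (ot_map_monotone oT' oT) i.
apply: (negligibleS _ (negligibleU (negligible_bigcup_count le)
  (negligible_bigcup_count ge))) => x /= TT'.
have [i] : exists i, T x ord0 i != T' x ord0 i.
  apply: contrapT => /forallNP h; apply: TT'; apply/rowP => i.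
  by apply/eqP; have /negP := h i; rewrite negbK.
by rewrite neq_lt => /orP[lt|lt]; [right|left]; exists i.
Qed.

End couplings.

(** * Wasserstein geometry *)

Section cauchy_schwarz.
Context {dO : measure_display} {O : measurableType dO} {R : realType}.
Variable (P : probability O R).
Context {d : nat}.
Implicit Types f g h : O -> 'rV[R]_d.

Lemma ip_comb a b f g : L2 P f -> L2 P g ->
  ip P (fun x => a *: f x + b *: g x) (fun x => a *: f x + b *: g x) =
  a ^+ 2 * ip P f f + 2 * a * b * ip P f g + b ^+ 2 * ip P g g.
Proof.
move=> Lf Lg; have Laf := L2Z a Lf; have Lbg := L2Z b Lg.
rewrite ipDD// !ipZl// !(ipC _ _ (fun x => _ *: _)) !ipZl//.
by rewrite (ipC _ g f); ring.
Qed.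

Lemma cauchy_schwarz f g : L2 P f -> L2 P g ->
  ip P f g ^+ 2 <= ip P f f * ip P g g.
Proof.
move=> Lf Lg; set a := ip P f f; set b := ip P f g; set c := ip P g g.
have q s t : 0 <= s ^+ 2 * a + 2 * s * t * b + t ^+ 2 * c.
  by rewrite -ip_comb//; exact: ip_ge0.
have c0 : 0 <= c by exact: ip_ge0.
have [c_gt0|] := ltP 0 c.
  (* At these coefficients the quadratic form factors as [c] times the desired difference. *)
  have := q c (- b).
  rewrite (_ : _ + _ = c * (a * c - b ^+ 2)); last by ring.
  by rewrite pmulr_rge0// subr_ge0.
move=> c_le0; have {}c0 : c = 0 by apply/eqP; rewrite eq_le c_le0.
have [->|b0] := eqVneq b 0; first by rewrite c0 mulr0 expr0n.
(* With [c = 0] the form is affine in [t]; this [t] gives it the value -1. *)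
have := q 1 (- (a + 1) / (2 * b)); rewrite c0 mulr0 addr0 expr1n mul1r mulr1.
rewrite (_ : 2 * _ * b = - (a + 1)); last by field.
by move=> h; exfalso; lra.
Qed.

Lemma minkowski f g : L2 P f -> L2 P g ->
  Num.sqrt (ip P (fun x => f x + g x) (fun x => f x + g x)) <=
  Num.sqrt (ip P f f) + Num.sqrt (ip P g g).
Proof.
move=> Lf Lg.
have h : 0 <= Num.sqrt (ip P f f) + Num.sqrt (ip P g g) by rewrite addr_ge0 ?sqrtr_ge0.
rewrite -(ger0_norm h) -sqrtr_sqr ler_wsqrtr// ipDD// sqrrD.
rewrite !sqr_sqrtr ?ip_ge0// lerD2r lerD2l -sqrtrM ?ip_ge0//.
have : ip P f g <= Num.sqrt (ip P f f * ip P g g).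
  by rewrite (le_trans (ler_norm _))// -sqrtr_sqr ler_wsqrtr// cauchy_schwarz.
by rewrite mulr2n; lra.
Qed.

Lemma ae_eq_ipr f g h : L2 P f -> L2 P g -> L2 P h ->
  {ae P, forall x, g x = h x} -> ip P f g = ip P f h.
Proof.
move=> Lf Lg Lh gh; congr fine; apply: ae_eq_integral => //.
- by apply: (measurable_int P); exact: L2_integrable_dotmul.
- by apply: (measurable_int P); exact: L2_integrable_dotmul.
by apply: filterS gh => x gx _ /=; rewrite gx.
Qed.

End cauchy_schwarz.

Section W2_geometry.
Context {R : realType} {d : nat}.
Implicit Types mu nu rho : P2 R d.

Lemma W2_ge0 mu nu : 0 <= W2 mu nu. Proof. exact: sqrtr_ge0. Qed.

Lemma W2_sqr mu nu : W2 mu nu ^+ 2 = fine (ot_cost mu nu).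
Proof. by rewrite sqr_sqrtr// fine_ge0// ot_cost_ge0. Qed.

Lemma ip_subC (rho : probability 'rV[R]_d R) (f g : 'rV[R]_d -> 'rV[R]_d) :
  ip rho (fun x => f x - g x) (fun x => f x - g x) =
  ip rho (fun x => g x - f x) (fun x => g x - f x).
Proof.
by apply: eq_Rintegral => x _; rewrite -opprB dotmulNl dotmulNr opprK.
Qed.

Lemma W2_sqr_le_ip f g rho mu nu : is_pushforward f rho mu ->
  is_pushforward g rho nu ->
  W2 mu nu ^+ 2 <= ip rho (fun x => g x - f x) (fun x => g x - f x).
Proof.
move=> fmu gnu; rewrite ip_subC; have := ot_cost_le_ip fmu gnu; rewrite W2_sqr.
by have := ot_cost_ge0 mu nu; case: (ot_cost mu nu) => [r||].
Qed.

Lemma W2_sqr_ot_map mu nu T : is_ot_map mu nu T ->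
  W2 mu nu ^+ 2 = ip mu (fun x => T x - x) (fun x => T x - x).
Proof. by move=> oT; rewrite W2_sqr (is_ot_mapP oT). Qed.

Lemma W2_ot_map mu nu T : is_ot_map mu nu T ->
  W2 mu nu = Num.sqrt (ip mu (fun x => T x - x) (fun x => T x - x)).
Proof. by move=> oT; rewrite -(W2_sqr_ot_map oT) sqrtr_sqr ger0_norm// W2_ge0. Qed.

Lemma is_pushforward_id mu nu : (forall A, measurable A -> nu A = mu A) ->
  is_pushforward id mu nu.
Proof. by move=> E; split; [exact: measurable_id|]. Qed.

Lemma W2_eq0 mu nu : (forall A, measurable A -> nu A = mu A) -> W2 mu nu = 0.
Proof.
move=> E; apply/eqP; rewrite -sqrf_eq0; apply/eqP/le_anti; rewrite sqr_ge0 andbT.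
apply: le_trans (W2_sqr_le_ip (@is_pushforward_id mu mu _) (is_pushforward_id E)) _ => //.
rewrite /ip /Rintegral integral0_eq// => x _.
by rewrite subrr -(scale0r 0) dotmulZl mul0r.
Qed.

(** Reverse the optimal coupling. Symmetry of [W2] follows where optimal maps exist in both
    directions. *)
Lemma ot_maps_W2_le mu nu T : is_ot_map mu nu T -> W2 nu mu <= W2 mu nu.
Proof.
move=> oT; rewrite -(ler_pXn2r (ltn0Sn 1)) ?nnegrE ?W2_ge0//.
rewrite (W2_sqr_ot_map oT) (ip_subC _ T).
exact: W2_sqr_le_ip oT.1 (@is_pushforward_id mu mu _).
Qed.

(** The composite [S \o T] couples [mu] with [rho], and Minkowski in [L2 mu] splits its
    displacement. *)
Lemma W2_triangle mu nu rho T S : is_ot_map mu nu T -> is_ot_map nu rho S ->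
  W2 mu rho <= W2 mu nu + W2 nu rho.
Proof.
move=> oT oS; have LT := ot_map_L2 oT; have LS := ot_map_L2 oS.
have cST := is_pushforward_comp oT.1 oS.1.
have LST : L2 mu (fun x => S (T x) - T x).
  by apply: L2B; [exact: is_pushforward_L2 cST|exact: is_pushforward_L2 oT.1].
have eS : W2 nu rho =
    Num.sqrt (ip mu (fun x => S (T x) - T x) (fun x => S (T x) - T x)).
  by rewrite (W2_ot_map oS) -(is_pushforward_ip oT.1 LS.1).
rewrite eS (W2_ot_map oT) addrC.
apply: le_trans (minkowski LST LT).
rewrite -[leLHS]ger0_norm ?W2_ge0// -sqrtr_sqr ler_wsqrtr//.
apply: le_trans (W2_sqr_le_ip (@is_pushforward_id mu mu _) cST) _ => //.
rewrite le_eqVlt; apply/orP; left; apply/eqP.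
by apply: eq_Rintegral => x _ /=; rewrite subrKA.
Qed.

(* Equality case of Minkowski: if the intermediate point lies at the right
   distances, the displacements U - id and V o U - U are parallel. *)
Lemma geodesic_ot_map mu nu rho U V T (s : R) : 0 < s < 1 ->
  is_ot_map mu nu T -> is_ot_map mu rho U -> is_ot_map rho nu V ->
  W2 mu rho = s * W2 mu nu -> W2 rho nu = (1 - s) * W2 mu nu ->
  is_ot_map mu nu (V \o U) /\
  {ae mu, forall x, U x = (1 - s) *: x + s *: V (U x)}.
Proof.
move=> /andP[s0 s1] oT oU oV WU WV.
have LU := ot_map_L2 oU; have LV := ot_map_L2 oV.
have cVU := is_pushforward_comp oU.1 oV.1.
have LVU : L2 mu (fun x => V (U x) - U x).
  by apply: L2B; [exact: is_pushforward_L2 cVU|exact: is_pushforward_L2 oU.1].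
set u := fun x => U x - x in LU; set v := fun x => V (U x) - U x in LVU.
have uu : ip mu u u = s ^+ 2 * W2 mu nu ^+ 2.
  by rewrite -(W2_sqr_ot_map oU) WU exprMn.
have vv : ip mu v v = (1 - s) ^+ 2 * W2 mu nu ^+ 2.
  by rewrite -exprMn -WV (W2_sqr_ot_map oV) -(is_pushforward_ip oU.1 LV.1).
have uv_id : (fun x => u x + v x) = (fun x => V (U x) - x).
  by apply/funext => x; rewrite /u /v addrC subrKA.
have le1 : W2 mu nu ^+ 2 <= ip mu u u + 2 * ip mu u v + ip mu v v.
  rewrite -ipDD// uv_id.
  exact: W2_sqr_le_ip (@is_pushforward_id mu mu _) cVU.
have le2 : 0 <= (1 - s) ^+ 2 * ip mu u u + 2 * (1 - s) * - s * ip mu u v +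
    (- s) ^+ 2 * ip mu v v by rewrite -ip_comb//; exact: ip_ge0.
rewrite uu vv in le1 le2.
(* [le1] bounds the cross term from below; [le2], the squared norm of [(1 - s) u - s v], bounds it
   from above. Equality then makes this field vanish almost everywhere. *)
have uv : ip mu u v = s * (1 - s) * W2 mu nu ^+ 2.
  apply/le_anti/andP; split; last by lra.
  rewrite -(ler_pM2l (_ : 0 < 2 * s * (1 - s))); last first.
    by rewrite !mulr_gt0// subr_gt0.
  by lra.
split.
  split => //; rewrite integral_sqnormE.
    rewrite -uv_id ipDD// uu vv uv (is_ot_mapP oT) -(W2_sqr_ot_map oT).
    by congr EFin; ring.
  by rewrite -[X in L2 _ X]uv_id; exact: L2D.
have : {ae mu, forall x, (1 - s) *: u x + - s *: v x = 0}.
  apply: ip_eq0_ae; first by apply: L2D; exact: L2Z.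
  by rewrite ip_comb// uu vv uv; ring.
apply: filterS => x; rewrite /u /v => h.
apply/eqP; rewrite -subr_eq0; apply/eqP; rewrite -h.
apply/rowP => i; rewrite !mxE; ring.
Qed.

End W2_geometry.

(** * Geodesically convex functionals *)

Lemma ae_eq_preimage (dO dT : measure_display) (O : measurableType dO)
    (T : measurableType dT) (R : realType) (P : {measure set O -> \bar R})
    (f g : O -> T) (A : set T) :
  measurable_fun setT f -> measurable_fun setT g -> measurable A ->
  {ae P, forall x, f x = g x} -> P (f @^-1` A) = P (g @^-1` A).
Proof.
move=> mf mg mA [N [mN N0 fgN]].
have mfA : measurable (f @^-1` A).
  by rewrite -[X in measurable X]setTI; exact: mf.
have mgA : measurable (g @^-1` A).
  by rewrite -[X in measurable X]setTI; exact: mg.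
have le X Y : measurable X -> measurable Y -> X `<=` Y `|` N -> (P X <= P Y)%E.
  move=> mX mY XY; have YN : (P (Y `|` N) <= P Y)%E.
    by rewrite -[leRHS]adde0 -[in leRHS]N0; exact: measureU2.
  by apply: le_trans YN; apply: le_measure; rewrite ?inE//; exact: measurableU.
apply: le_anti; apply/andP; split; apply: le => // x Ax.
  have [Nx|nNx] := pselect (N x); [by right|left].
  have fgx : f x = g x by apply: contrapT => h; apply: nNx; exact: fgN.
  by rewrite /preimage /= -fgx.
have [Nx|nNx] := pselect (N x); [by right|left].
have fgx : f x = g x by apply: contrapT => h; apply: nNx; exact: fgN.
by rewrite /preimage /= fgx.
Qed.

Section convex_functional.
Context {R : realType} {d : nat}.
Variable F : P2 R d -> \bar R.
Hypotheses (F_gtNy : forall mu, (-oo < F mu)%E)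
  (F_lsc : W2_lower_semicontinuous F) (F_convex : geodesically_convex F)
  (F_ac : domain_absolutely_continuous F) (F_maps : domain_has_ot_maps F).
Implicit Types mu nu rho : P2 R d.

Lemma domain_fin_num mu : (F mu < +oo)%E -> F mu \is a fin_num.
Proof. by move=> Fmu; rewrite fin_numE gt_eqF ?F_gtNy// lt_eqF. Qed.

(** A level strictly between the values would contradict semicontinuity at [nu]. This transfers [F]
    between elements of [P2] that agree only on measurable sets. *)
Lemma lsc_le mu nu : W2 nu mu = 0 -> (F nu <= F mu)%E.
Proof.
move=> W0; rewrite leNgt; apply/negP => lt.
have [a a1 a2] : exists2 a : R, (F mu < a%:E)%E & (a%:E < F nu)%E.
  move: lt (F_gtNy mu) (F_gtNy nu).
  case: (F mu) => [x||]//; case: (F nu) => [y||]// xy _ _.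
    by exists ((x + y) / 2); rewrite lte_fin; move: xy; rewrite lte_fin => xy; lra.
  by exists (x + 1); [rewrite lte_fin ltrDl|rewrite ltry].
have [e e0 /(_ mu)] := F_lsc a2; rewrite W0 => /(_ e0) a3.
by have := lt_trans a1 a3; rewrite ltxx.
Qed.

Lemma W2C mu nu : (F mu < +oo)%E -> (F nu < +oo)%E -> W2 mu nu = W2 nu mu.
Proof.
move=> Fm Fn; have [T oT] := F_maps Fm Fn; have [S oS] := F_maps Fn Fm.
by apply/le_anti; rewrite (ot_maps_W2_le oS) (ot_maps_W2_le oT).
Qed.

Lemma W2_domain_triangle mu nu rho :
  (F mu < +oo)%E -> (F nu < +oo)%E -> (F rho < +oo)%E ->
  W2 mu rho <= W2 mu nu + W2 nu rho.
Proof.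
move=> Fm Fn Fr; have [T oT] := F_maps Fm Fn; have [S oS] := F_maps Fn Fr.
exact: W2_triangle oT oS.
Qed.

(** Convexity supplies some geodesic, unrelated to [T]. Its point at time [s] lies in the domain, so
    optimal maps [U] to it and [V] from it exist; [V \o U] is optimal, hence equals [T] almost
    everywhere, and [U] is the interpolation of [T]. *)
Lemma interpolant mu nu T (s : R) : (F mu < +oo)%E -> (F nu < +oo)%E ->
  is_ot_map mu nu T -> 0 < s < 1 ->
  exists rho U, [/\ (F rho <= (1 - s)%:E * F mu + s%:E * F nu)%E,
    (F rho < +oo)%E, is_ot_map mu rho U, W2 mu rho = s * W2 mu nu &
    {ae mu, forall x, U x = (1 - s) *: x + s *: T x}].
Proof.
move=> Fm Fn oT /[dup] s01 /andP[s0 s1].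
have [lam [lam0 lam1 lamW] lamF] := F_convex mu nu.
have s01' : 0 <= s <= 1 by rewrite !ltW.
have le := lamF s s01'.
have Fl : (F (lam s) < +oo)%E.
  apply: le_lt_trans le _; rewrite -(fineK (domain_fin_num Fm)).
  by rewrite -(fineK (domain_fin_num Fn)) -!EFinM -EFinD ltry.
have [U oU] := F_maps Fm Fl; have [V oV] := F_maps Fl Fn.
have W0 : W2 mu (lam s) = s * W2 mu nu.
  rewrite -[in LHS]lam0 lamW ?lexx ?ler01//.
  by rewrite sub0r normrN gtr0_norm.
have W1 : W2 (lam s) nu = (1 - s) * W2 mu nu.
  rewrite -[in LHS]lam1 lamW ?lexx ?ler01//.
  by rewrite distrC gtr0_norm ?subr_gt0.
have [oVU UVU] := geodesic_ot_map s01 oT oU oV W0 W1.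
exists (lam s), U; split=> //.
have := ot_map_unique (F_ac Fm) oVU oT.
by apply: filterS2 UVU => x Ux VUT; rewrite Ux -VUT.
Qed.

Lemma convex_along_ot_map mu nu rho T (s : R) :
  (F mu < +oo)%E -> (F nu < +oo)%E -> is_ot_map mu nu T -> 0 < s < 1 ->
  is_pushforward (fun x => (1 - s) *: x + s *: T x) mu rho ->
  (F rho <= (1 - s)%:E * F mu + s%:E * F nu)%E.
Proof.
move=> Fm Fn oT s01 [mf rhoE].
have [sig [U [le _ [[mU sigE] _] _ UT]]] := interpolant Fm Fn oT s01.
apply: le_trans le; apply: lsc_le; apply: W2_eq0 => A mA.
by rewrite sigE// rhoE// /pushforward; apply: ae_eq_preimage.
Qed.

(** Apply the local inequality to the interpolant at a small time [s]: the displacement, the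
    distance and the convexity bound all scale with [s]. Divide by [s], then let [e] tend to
    zero. *)
Lemma subdifferential_ineq mu nu T xi : frechet_subdifferential F mu xi ->
  (F nu < +oo)%E -> is_ot_map mu nu T ->
  ip mu xi (fun x => T x - x) <= fine (F nu) - fine (F mu).
Proof.
move=> [Fm [mxi xi2] sub] Fn oT.
have Lxi : L2 mu xi by [].
have LT := ot_map_L2 oT.
set W := W2 mu nu; have W0 : 0 <= W by exact: W2_ge0.
suff H e : 0 < e -> ip mu xi (fun x => T x - x) - e * W <= fine (F nu) - fine (F mu).
  apply/ler_addgt0Pr => e e0.
  have eW : 0 < e / (W + 1) by rewrite divr_gt0// ltr_wpDl.
  have := H _ eW; rewrite lerBlDr => /le_trans; apply; rewrite lerD2l.
  rewrite mulrAC ler_pdivrMr ?ltr_wpDl// ler_pM2l//; lra.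
move=> e0; have [del del0 {}sub] := sub e e0.
(* This keeps [s < 1] and [s * W < del]; [W + 1] covers the case [W = 0]. *)
pose s := Num.min 2^-1 (del / (2 * (W + 1))).
have W1 : 0 < 2 * (W + 1) by rewrite mulr_gt0// ltr_wpDl.
have s0 : 0 < s by rewrite lt_min invr_gt0 ltr0n divr_gt0.
have s1 : s < 1.
  have : s <= 2^-1 by rewrite ge_min lexx.
  by move=> h; lra.
have sW : s * W < del.
  have : s * (2 * (W + 1)) <= del by rewrite -ler_pdivlMr// ge_min lexx orbT.
  have : 0 <= s * W by rewrite mulr_ge0// ltW.
  by move: s0; nra.
have [rho [U [le Fr oU WU UT]]] := interpolant Fm Fn oT (introT andP (conj s0 s1)).
have LU := ot_map_L2 oU.
have := sub rho U Fr; rewrite WU => /(_ sW oU).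
rewrite integral_dotmulE//.
have -> : ip mu xi (fun x => U x - x) = s * ip mu xi (fun x => T x - x).
  rewrite (ipC _ xi (fun x => T x - x)) -ipZl// [RHS]ipC; apply: ae_eq_ipr => //.
    exact: L2Z.
  apply: filterS UT => x ->; apply/rowP => i; rewrite !mxE; ring.
have fm := domain_fin_num Fm; have fn := domain_fin_num Fn.
have fr := domain_fin_num Fr; move: le.
rewrite -(fineK fm) -(fineK fn) -(fineK fr) -!EFinM -!EFinD !lee_fin /= => le h.
rewrite -/W in h; rewrite -(ler_pM2l s0); lra.
Qed.

End convex_functional.

(** * Adaptive step sizes *)

Section adaptive_regret.
Context {R : realType}.
(** Scalar data of the method: [f] is the gap to the minimum, [g] the squared gradient norm, [r] the
    radius and [dist] the distance to the minimizer. [p t.+1] stands for the square root of [Gsum]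
    at [t]; the shift gives [p 0 = 0]. *)
Variables (f g r p dist : nat -> R).
Hypotheses (f0 : forall t, 0 <= f t) (g0 : forall t, 0 <= g t)
  (r0 : 0 < r 0%N) (r_nd : {homo r : s t / (s <= t)%N >-> s <= t})
  (r_double : forall t, r t.+1 <= 2 * r t)
  (p_at0 : p 0%N = 0) (p_gt0 : forall t, 0 < p t.+1)
  (pS : forall t, p t.+1 ^+ 2 = p t ^+ 2 + g t)
  (dist0 : forall t, 0 <= dist t)
  (dist_le : forall t, dist t <= dist 0%N + r t)
  (dist_lip : forall s t, (s <= t)%N -> dist s - dist t <= 2 * r t)
  (descent : forall t, 2 * (r t * f t) <=
    p t.+1 * (dist t ^+ 2 - dist t.+1 ^+ 2) + r t ^+ 2 * (g t / p t.+1)).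

Let r_gt0 t : 0 < r t.
Proof. by apply: lt_le_trans r0 _; exact: r_nd. Qed.

Let p_ge0 t : 0 <= p t.
Proof. by case: t => [|t]; [rewrite p_at0|exact: ltW]. Qed.

Let p_nd : {homo p : s t / (s <= t)%N >-> s <= t}.
Proof.
apply: homo_leq => [//|? ? ?|t]; first exact: le_trans.
by rewrite -(ler_pXn2r (ltn0Sn 1)) ?nnegrE// pS lerDl.
Qed.

(** Factor [g t] as a difference of squares and use [p t <= p t.+1]; the right-hand sides
    telescope. *)
Let increment_le t : g t / p t.+1 <= 2 * (p t.+1 - p t).
Proof.
rewrite ler_pdivrMr// (_ : g t = (p t.+1 - p t) * (p t.+1 + p t)); last first.
  by rewrite -subr_sqr pS addrAC subrr add0r.
rewrite mulrAC [leRHS]mulrAC -mulrA [leRHS]mulrC.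
have pp : p t <= p t.+1 by exact: p_nd.
have := p_gt0 t; move: pp; set a := p t; set b := p t.+1 => *; nra.
Qed.

Lemma weighted_regret n :
  \sum_(t < n) r t * f t <= 3 * (r n * (dist 0%N + r n)) * p n.
Proof.
(* [D t] factors into a difference at most [2 * r n] and a sum at most [2 * (dist 0 + r n)], which
   gives [M]. *)
pose M := 4 * (r n * (dist 0%N + r n)); pose D t := dist t ^+ 2 - dist n ^+ 2.
have DM t : (t <= n)%N -> D t <= M.
  move=> tn; rewrite /D /M.
  have := dist_lip tn; have := dist_le t; have := dist_le n.
  have := dist0 t; have := dist0 n; have := r_nd tn; have := r_gt0 n.
  have := dist0 0%N.
  move: (dist 0%N) (dist t) (dist n) (r n) (r t) => a b c u v *.
  rewrite subr_sqr; have [bc|bc] := leP b c; last by nra.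
  apply: (@le_trans _ _ 0); last by nra.
  by rewrite mulr_le0_ge0 ?subr_le0 ?addr_ge0.
(* Summation by parts as an invariant: the boundary term [p k * D k] disappears at [k = n], where
   [D] is zero. *)
have H k : (k <= n)%N ->
    2 * (\sum_(t < k) r t * f t) <= (M + 2 * r n ^+ 2) * p k - p k * D k.
  elim: k => [_|k IH kn]; first by rewrite big_ord0 p_at0; lra.
  rewrite big_ord_recr/= mulrDr.
  have := IH (ltnW kn); have := DM k (ltnW kn); have := descent k.
  have rk : r k ^+ 2 * (g k / p k.+1) <= r n ^+ 2 * (2 * (p k.+1 - p k)).
    apply: ler_pM => //; first exact: sqr_ge0.
    - by rewrite divr_ge0.
    - by rewrite ler_pXn2r ?nnegrE ?(ltW (r_gt0 _))//; apply: r_nd; exact: ltnW.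
  have pk : p k <= p k.+1 by exact: p_nd.
  move: rk pk; rewrite /D.
  move: (_ * (g k / _)) (\sum_(_ < k) _) (r k * f k) (r n ^+ 2) => a b c e rk pk h1 h2 h3.
  have : 0 <= (p k.+1 - p k) * (M - (dist k ^+ 2 - dist n ^+ 2)).
    by rewrite mulr_ge0 ?subr_ge0.
  by move=> *; nra.
have := H n (leqnn n); rewrite /D subrr mulr0 subr0 /M.
have := p_ge0 n; have := dist0 0%N; have := r_gt0 n.
move: (\sum_(_ < _) _) (p n) (dist 0%N) (r n) => S P a u u0 a0 P0 h.
have : 0 <= a * u * P by rewrite !mulr_ge0// ltW.
by move=> *; nra.
Qed.

Lemma uniform_regret n :
  \sum_(t < n.+1) f t <=
  12 * ((dist 0%N * (1 + ln (r n.+1 / r 0%N)) + r n.+1) * p n.+1).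
Proof.
pose S k := \sum_(t < k) r t * f t; pose P := p n.+1.
have a0 := dist0 0%N; have P0 : 0 <= P by exact: p_ge0.
have SP k : (k <= n.+1)%N -> S k <= 3 * (r k * (dist 0%N + r k)) * P.
  move=> kn; apply: le_trans (weighted_regret k) _.
  rewrite ler_wpM2l ?p_nd// mulr_ge0// mulr_ge0 ?(ltW (r_gt0 _))//.
  by rewrite addr_ge0// ltW.
(* Second summation by parts: each change of weight from [r k] to [r k.+1] costs a logarithmic
   increment and a telescoping one. *)
have H k : (k <= n)%N -> \sum_(t < k.+1) f t <= S k.+1 / r k +
    P * (6 * dist 0%N * ln (r k / r 0%N) + 6 * (r k - r 0%N)).
  elim: k => [_|k IH kn].
    rewrite big_ord1 /S big_ord1 /= divff ?gt_eqF// ln1 subrr !mulr0 addr0 mulr0.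
    by rewrite addr0 mulrAC divff ?gt_eqF// mul1r.
  rewrite big_ord_recr/= (le_trans (lerD (IH (ltnW kn)) (lexx _)))//.
  rewrite [in leRHS]/S big_ord_recr/= -/(S k.+1) (mulrDl _ _ (r k.+1)^-1).
  rewrite (mulrAC (r k.+1)) divff ?gt_eqF// mul1r.
  set x := r k.+1 / r k.
  have x1 : 1 <= x by rewrite ler_pdivlMr// mul1r r_nd.
  have x2 : x <= 2 by rewrite ler_pdivrMr.
  have x0 : 0 < x by rewrite divr_gt0.
  (* This is the bound of [ln (1 + y)] by [y] at [y = x^-1 - 1]. Multiplied by [x <= 2] it yields
     [x - 1 <= 2 * ln x], the use of the doubling hypothesis. *)
  have lnx : 1 - x^-1 <= ln x.
    have : -1 < x^-1 - 1 by rewrite ltrBrDr addNr invr_gt0.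
    by move/le_ln1Dx; rewrite addrC subrK lnV ?posrE//; lra.
  have lnx' : x - 1 <= 2 * ln x.
    have ge0 : 0 <= 1 - x^-1 by rewrite subr_ge0 invf_le1.
    have : x * (1 - x^-1) <= 2 * ln x by apply: ler_pM => //; exact: ltW.
    by rewrite mulrBr mulr1 divff// gt_eqF.
  have lnr : ln (r k.+1 / r 0%N) = ln x + ln (r k / r 0%N).
    by rewrite !ln_div ?posrE//; ring.
  have key : S k.+1 / r k - S k.+1 / r k.+1 <=
      P * (6 * dist 0%N * ln x + 6 * (r k.+1 - r k)).
    rewrite -mulrBr (_ : _ - _ = (x - 1) / r k.+1); last first.
      by rewrite /x; field; rewrite !gt_eqF.
    have xr : 0 <= (x - 1) / r k.+1 by rewrite divr_ge0 ?subr_ge0// ltW.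
    apply: le_trans (ler_wpM2r xr (SP _ _)) _; first exact: ltnW.
    rewrite [leLHS](_ : _ = P * (3 * dist 0%N * (x - 1) + 3 * r k.+1 * (x - 1))); last first.
      by field; rewrite gt_eqF.
    rewrite ler_wpM2l// lerD//.
      rewrite (_ : 6 * _ * _ = 3 * dist 0%N * (2 * ln x)); last by ring.
      by rewrite ler_wpM2l// mulr_ge0.
    rewrite (_ : 3 * _ * _ = 3 * (x * (r k.+1 - r k))); last first.
      by rewrite /x; field; rewrite gt_eqF.
    rewrite (_ : 6 * _ = 3 * (2 * (r k.+1 - r k))); last by ring.
    by rewrite ler_wpM2l// ler_wpM2r// subr_ge0 r_nd.
  rewrite lnr; move: key; lra.
apply: le_trans (H n (leqnn n)) _.
have Sn : S n.+1 / r n <= 6 * (dist 0%N + r n.+1) * P.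
  rewrite ler_pdivrMr// (le_trans (SP _ (leqnn _)))//.
  rewrite (_ : 6 * _ * P * r n = 3 * ((2 * r n) * (dist 0%N + r n.+1)) * P); last by ring.
  rewrite ler_wpM2r// ler_wpM2l// ler_wpM2r//.
  by rewrite addr_ge0// ltW.
have lnn : ln (r n / r 0%N) <= ln (r n.+1 / r 0%N).
  by rewrite ler_ln ?posrE ?divr_gt0// ler_pM2r ?invr_gt0// r_nd.
have ln0 : 0 <= ln (r n / r 0%N).
  by apply: ln_ge0; rewrite ler_pdivlMr// mul1r r_nd.
have rn : r n <= r n.+1 by exact: r_nd.
have := r_gt0 n.
move: Sn lnn ln0 rn r0; rewrite -/P.
move: a0; move: (S _ / _) => s; move: (ln (r n / _)) => l; move: (ln _) => l'.
move: (r n.+1) (r n) (r 0%N) (dist 0%N) => u v w a a0 hs ll l0 uv w0 v0.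
(* Up to the factor [P], the boundary term gives [6 * (a + u)] and the increments
   [6 * a * l' + 6 * u], whence the constant 12. *)
have h1 : P * (6 * a * l + 6 * (v - w)) <= P * (6 * a * l' + 6 * u).
  rewrite ler_wpM2l// lerD//; last by lra.
  by rewrite ler_wpM2l// mulr_ge0.
have h2 : 0 <= P * (6 * a * l') by rewrite !mulr_ge0// (le_trans l0).
have h3 : 0 <= P * a by rewrite mulr_ge0.
have h4 : 0 <= P * u by rewrite mulr_ge0//; lra.
by lra.
Qed.

End adaptive_regret.

Section rbar_theory.
Context {R : realType} {d : nat}.
Variables (mu : nat -> P2 R d) (reps : R).
Hypothesis reps_gt0 : 0 < reps.

Lemma W2_le_rbar s t : (s <= t)%N -> W2 (mu 0%N) (mu s) <= rbar mu reps t.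
Proof.
move=> st; rewrite /rbar le_max; apply/orP; right.
exact: (le_bigmax _ (fun s : 'I_t.+1 => W2 (mu 0%N) (mu s)) (Ordinal (st : s < t.+1)%N)).
Qed.

Lemma rbar_le t x : reps <= x ->
  (forall s, (s <= t)%N -> W2 (mu 0%N) (mu s) <= x) -> rbar mu reps t <= x.
Proof.
move=> rx Wx; rewrite /rbar ge_max rx /=; apply: bigmax_le => [|s _].
  by rewrite (le_trans (ltW reps_gt0)).
by apply: Wx; rewrite -ltnS.
Qed.

Lemma reps_le_rbar t : reps <= rbar mu reps t.
Proof. by rewrite /rbar le_max lexx. Qed.

Lemma rbar_nd : {homo rbar mu reps : s t / (s <= t)%N >-> s <= t}.
Proof.
move=> s t st; apply: rbar_le => [|u us]; first exact: reps_le_rbar.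
by apply: W2_le_rbar; exact: leq_trans st.
Qed.

Lemma rbar0 : rbar mu reps 0 = reps.
Proof.
apply/le_anti; rewrite reps_le_rbar andbT; apply: rbar_le => // s.
by rewrite leqn0 => /eqP ->; rewrite W2_eq0// ltW.
Qed.

End rbar_theory.

(** * Forward Euler steps and averaged iterates *)

Section iterates.
Context {R : realType} {d : nat}.
Variable F : P2 R d -> \bar R.
Hypotheses (F_gtNy : forall mu, (-oo < F mu)%E)
  (F_lsc : W2_lower_semicontinuous F) (F_convex : geodesically_convex F)
  (F_ac : domain_absolutely_continuous F) (F_maps : domain_has_ot_maps F).
Variables (pi : P2 R d) (mu : nat -> P2 R d) (xi : nat -> 'rV[R]_d -> 'rV[R]_d).
Hypotheses (F_pi : (F pi < +oo)%E)
  (xi_sub : forall t, frechet_subdifferential F (mu t) (xi t)).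

Let F_mu t : (F (mu t) < +oo)%E.
Proof. by have [] := xi_sub t. Qed.

Let xi_L2 t : L2 (mu t) (xi t).
Proof. by have [_ []] := xi_sub t. Qed.

Lemma sqL2_ip t : fine (sqL2 (mu t) (xi t)) = ip (mu t) (xi t) (xi t).
Proof. by []. Qed.

Lemma euler_displacement (eta : R) t :
  is_pushforward (fun x => x - eta *: xi t x) (mu t) (mu t.+1) ->
  W2 (mu t) (mu t.+1) ^+ 2 <= eta ^+ 2 * fine (sqL2 (mu t) (xi t)).
Proof.
move=> step; apply: le_trans (W2_sqr_le_ip (@is_pushforward_id _ _ (mu t) (mu t) _) step) _ => //.
rewrite (_ : (fun x => _) = (fun x => - eta *: xi t x)); last first.
  by apply/funext => x /=; rewrite addrAC subrr add0r scaleNr.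
rewrite ipZl//; last exact: L2Z.
by rewrite ipC ipZl// sqL2_ip; lra.
Qed.

Lemma euler_descent (eta : R) t : 0 <= eta ->
  is_pushforward (fun x => x - eta *: xi t x) (mu t) (mu t.+1) ->
  W2 (mu t.+1) pi ^+ 2 <= W2 (mu t) pi ^+ 2
    - 2 * eta * (fine (F (mu t)) - fine (F pi))
    + eta ^+ 2 * fine (sqL2 (mu t) (xi t)).
Proof.
move=> eta0 step; have [T oT] := F_maps (F_mu t) F_pi.
have LT := ot_map_L2 oT.
apply: le_trans (W2_sqr_le_ip step oT.1) _.
rewrite (_ : (fun x => _) = (fun x => 1 *: (T x - x) + eta *: xi t x)); last first.
  by apply/funext => x; rewrite scale1r opprB addrCA addrC.
rewrite ip_comb// -(W2_sqr_ot_map oT) expr1n mul1r mulr1 sqL2_ip lerD2r lerD2l.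
(* The cross term pairs [xi t] with the displacement towards [pi], which is the left-hand side of
   the first-order inequality. *)
have := subdifferential_ineq F_gtNy F_convex F_ac F_maps (xi_sub t) F_pi oT.
rewrite ipC => sub.
rewrite -mulrN opprB -mulrA -[leRHS]mulrA ler_wpM2l// ler_wpM2l//.
Qed.

(** Convexity at parameter [n.+2%:R^-1], multiplied by [n.+2], adds one summand to the right.
    Finiteness travels along, since each convexity step needs the current average in the domain. *)
Lemma average_bound (mub : nat -> P2 R d) : uniform_averages mu mub ->
  forall n, (F (mub n.+1) < +oo)%E /\
    n.+1%:R * fine (F (mub n.+1)) <= \sum_(t < n.+1) fine (F (mu t)).
Proof.
move=> [mub1 mubS]; elim=> [|n [Fn IH]].
  have le : (F (mub 1%N) <= F (mu 0%N))%E.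
    by apply: lsc_le => //; apply: W2_eq0 => A mA; rewrite mub1.
  have F1 := le_lt_trans le (F_mu 0).
  split => //; rewrite mul1r big_ord1 -lee_fin !fineK//; exact: domain_fin_num.
have [T oT push] := mubS n.+1 isT.
have s01 : 0 < (n.+2%:R^-1 : R) < 1.
  by rewrite invr_gt0 ltr0n/= invf_lt1 ?ltr0n// ltr1n.
have le := convex_along_ot_map F_gtNy F_lsc F_convex F_ac F_maps Fn (F_mu _) oT s01 push.
have fn := domain_fin_num F_gtNy Fn; have fm := domain_fin_num F_gtNy (F_mu n.+1).
have FS : (F (mub n.+2) < +oo)%E.
  apply: le_lt_trans le _; rewrite -(fineK fn) -(fineK fm).
  by rewrite -!EFinM -EFinD ltry.
split => //; move: le; rewrite -(fineK fn) -(fineK fm).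
rewrite -(fineK (domain_fin_num F_gtNy FS)) -!EFinM -EFinD lee_fin /= => le.
rewrite big_ord_recr/=; apply: le_trans (lerD IH (lexx _)).
rewrite -(ler_pM2l (_ : 0 < n.+2%:R :> R)) ?ltr0n// in le.
rewrite (le_trans le)// mulrDr mulrA mulrBr mulr1 divff ?pnatr_eq0//.
rewrite mulrA divff ?pnatr_eq0// mul1r lerD2r.
by rewrite -[n.+2%:R]natr1 addrK.
Qed.

End iterates.

(** * Suboptimality of the averages *)

Theorem proposition48 (R : realType) :
  exists2 C : R, 0 < C &
  forall (d : nat) (F : P2 R d -> \bar R)
    (hF_gtNy : forall mu : P2 R d, (-oo < F mu)%E)
    (hF_proper : proper_functional F)
    (hF_lsc : W2_lower_semicontinuous F)
    (hF_convex : geodesically_convex F)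
    (hF_ac : domain_absolutely_continuous F)
    (hF_maps : domain_has_ot_maps F)
    (pi : P2 R d) (hpi : is_minimizer F pi)
    (reps : R) (hreps : 0 < reps)
    (mu : nat -> P2 R d) (xi : nat -> 'rV[R]_d -> 'rV[R]_d)
    (hxi : forall t : nat, is_W2_gradient F (mu t) (xi t))
    (hG : forall t : nat, 0 < Gsum mu xi t)
    (hmu : forward_euler mu xi (adaptive_step mu xi reps))
    (mub : nat -> P2 R d) (hmub : uniform_averages mu mub)
    (T : nat) (hT : (1 <= T)%N),
  (F (mub T) - F pi <=
    (C * (((W2 (mu 0%N) pi * log_plus (rbar mu reps T / reps)
             + rbar mu reps T) * Num.sqrt (Gsum mu xi T.-1)) / T%:R))%:E)%E.
Proof.
exists 12 => // d F F_gtNy [nu0 Fnu0] F_lsc F_convex F_ac F_maps pi pi_min reps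
  reps_gt0 mu xi grad G_gt0 euler mub avg [//|n] _.
have F_pi : (F pi < +oo)%E by exact: le_lt_trans (pi_min nu0) Fnu0.
have sub t : frechet_subdifferential F (mu t) (xi t) by have [] := grad t.
have F_mu t : (F (mu t) < +oo)%E by have [] := sub t.
have [F_mub mub_le] := average_bound F_gtNy F_lsc F_convex F_ac F_maps sub avg n.
pose g t := fine (sqL2 (mu t) (xi t)).
pose p t := Num.sqrt (\sum_(s < t) g s).
pose f t := fine (F (mu t)) - fine (F pi).
have g0 t : 0 <= g t by rewrite /g sqL2_ip ip_ge0.
have sum0 t : 0 <= \sum_(s < t) g s by exact: sumr_ge0.
have p_gt0 t : 0 < p t.+1 by rewrite sqrtr_gt0; exact: G_gt0.
have fin nu : (F nu < +oo)%E -> F nu \is a fin_num by exact: domain_fin_num.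
have f0 t : 0 <= f t.
  by rewrite subr_ge0 -lee_fin !fineK ?fin//; exact: pi_min.
have r_gt0 t : 0 < rbar mu reps t by exact: lt_le_trans (reps_le_rbar _ _ _).
have pS t : p t.+1 ^+ 2 = p t ^+ 2 + g t.
  by rewrite !sqr_sqrtr// big_ord_recr.
have etaE t : adaptive_step mu xi reps t * p t.+1 = rbar mu reps t.
  by rewrite /adaptive_step divfK// gt_eqF//; exact: p_gt0.
have eta0 t : 0 <= adaptive_step mu xi reps t.
  by rewrite divr_ge0 ?sqrtr_ge0// ltW.
(* The squared step is at most [eta ^ 2 * g t], and [g t <= p t.+1 ^ 2] with
   [eta * p t.+1 = rbar t]. Hence [rbar] at most doubles in one step. *)
have step_le t : W2 (mu t) (mu t.+1) <= rbar mu reps t.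
  rewrite -(ler_pXn2r (ltn0Sn 1)) ?nnegrE ?W2_ge0 ?(ltW (r_gt0 _))//.
  apply: le_trans (euler_displacement sub (euler t)) _.
  rewrite -[in leRHS]etaE [leRHS]exprMn ler_wpM2l ?sqr_ge0// pS lerDr.
  exact: sqr_ge0.
have tri i j k : (F i < +oo)%E -> (F j < +oo)%E -> (F k < +oo)%E ->
  W2 i k <= W2 i j + W2 j k by exact: W2_domain_triangle.
have sym i : W2 (mu i) (mu 0%N) = W2 (mu 0%N) (mu i) by exact: (W2C F_maps).
have W2_le s t : (s <= t)%N -> W2 (mu s) (mu t) <= 2 * rbar mu reps t.
  move=> st; apply: le_trans (tri _ (mu 0%N) _ _ _ _) _ => //.
  rewrite sym; have := @W2_le_rbar _ _ mu reps _ _ st.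
  have := @W2_le_rbar _ _ mu reps _ _ (leqnn t); lra.
have regret : \sum_(t < n.+1) f t <= 12 * ((W2 (mu 0%N) pi *
    (1 + ln (rbar mu reps n.+1 / rbar mu reps 0)) + rbar mu reps n.+1) * p n.+1).
  apply: (@uniform_regret R f g (rbar mu reps) p (fun t => W2 (mu t) pi)) => //.
  - exact: rbar_nd.
  - move=> t; apply: rbar_le => // [|s].
      by have := reps_le_rbar mu reps t; have := r_gt0 t; lra.
    rewrite leq_eqVlt => /predU1P[->|st].
      apply: le_trans (tri _ (mu t) _ _ _ _) _ => //.
      have := @W2_le_rbar _ _ mu reps _ _ (leqnn t); have := step_le t; lra.
    by have := @W2_le_rbar _ _ mu reps s t st; have := r_gt0 t; lra.
  - by rewrite /p big_ord0 sqrtr0.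
  - by move=> t; exact: W2_ge0.
  - move=> t; apply: le_trans (tri _ (mu 0%N) _ _ _ _) _ => //.
    by rewrite sym addrC lerD2l W2_le_rbar.
  - move=> s t st; rewrite lerBlDr.
    by apply: le_trans (tri _ (mu t) _ _ _ _) _ => //; rewrite lerD2r W2_le.
  (* Multiplying the descent inequality by [p t.+1], the ratio of [rbar t] to the step size, gives
     the weighted form. *)
  move=> t; have := euler_descent F_gtNy F_convex F_ac F_maps F_pi sub (eta0 t) (euler t).
  rewrite -/(f t) -/(g t) -(ler_pM2l (p_gt0 t)) -etaE => h.
  have gE : (adaptive_step mu xi reps t * p t.+1) ^+ 2 * (g t / p t.+1) =
      p t.+1 * (adaptive_step mu xi reps t ^+ 2 * g t).
    by field; rewrite gt_eqF.
  rewrite gE; move: h; lra.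
rewrite -(fineK (fin _ F_mub)) -(fineK (fin _ F_pi)) -EFinB lee_fin.
rewrite mulrA ler_pdivlMr ?ltr0n//.
apply: le_trans _ (le_trans regret _); last by rewrite rbar0.
rewrite (_ : \sum_(t < _) f t =
    \sum_(t < n.+1) fine (F (mu t)) - n.+1%:R * fine (F pi)); last first.
  by rewrite big_split/= sumrN sumr_const card_ord mulr_natl.
by rewrite mulrBl mulrC [X in _ - X <= _]mulrC lerD2r.
Qed.
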